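(* The Team Selection problem (defined in the context) is NP-hard; that is, it cannot be solved in polynomial time unless $\mathrm{P}=\mathrm{NP}$.
   Context: An instance of the Team Selection problem consists of a set of experts $E=\{e_1,\dots,e_n\}$, a number of past rounds $k\ge 1$, real numbers $y_{it}$ ($1\le i\le n$, $1\le t\le k$) giving the prediction of expert $e_i$ in round $t$, real numbers $x_t$ giving the actual outcome in round $t$, and a team size $m$ with $1\le m\le n$. The task is to find a subset $S\subseteq E$ with $|S|=m$ minimizing the sum of squared errors of the averaged prediction, $$f(S)=\sum_{t=1}^k\Big(\frac{1}{|S|}\sum_{e_i\in S}y_{it}-x_t\Big)^2 .$$ Equivalently, minimize $\sum_{t=1}^k\big(\sum_{i=1}^n w_iy_{it}-x_t\big)^2$ subject to $\sum_i w_i=1$ and $w_i\in\{0,1/m\}$ for all $i$ (the members of $S$ being the experts with $w_i=1/m$). (Solving this for every $m=1,\dots,n$ yields a subset $S$ of arbitrary size minimizing $f(S)$.) *)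

(* Defs.v *)
From HB Require Import structures.
From mathcomp Require Import all_boot all_order all_algebra.

Set Implicit Arguments.
Unset Strict Implicit.
Unset Printing Implicit Defensive.

Import Order.TTheory GRing.Theory Num.Theory.

Definition word := seq bool.
Definition language := word -> Prop.

(* [None] is the blank, [Some (inl b)] an input/output bit, [Some (inr g)] an
   auxiliary symbol of the machine. *)
Definition symbol (G : finType) : finType := option (bool + G)%type.

(* [None] leaves the head in place, [Some false] moves it left and [Some true]
   moves it right. *)
Definition move : finType := option bool.

(* A nondeterministic machine with [extra.+1] two-way infinite tapes. A
   transition gives a new state and, for each tape, the symbol to write and the
   move to make. A configuration with no applicable transition is halting. *)
Record machine := Machine {
  extra : nat;
  state : finType;
  aux : finType;
  start : state;
  accepting : {set state};
  trans : state -> {ffun 'I_extra.+1 -> symbol aux} ->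
          {set state * {ffun 'I_extra.+1 -> symbol aux * move}}
}.

Definition deterministic (M : machine) : Prop :=
  forall (q : state M) a, #|trans q a| <= 1.

(* [(l, r)]: the head is on the first cell of [r], the cells of [l] are those to
   its left, nearest first, and all remaining cells on both sides are blank. *)
Definition tape (G : finType) : eqType := (seq (symbol G) * seq (symbol G))%type.

Definition scan (G : finType) (t : tape G) : symbol G := head None t.2.

Definition act (G : finType) (am : symbol G * move) (t : tape G) : tape G :=
  let r := am.1 :: behead t.2 in
  match am.2 with
  | None => (t.1, r)
  | Some false => (behead t.1, head None t.1 :: r)
  | Some true => (am.1 :: t.1, behead t.2)
  end.

Definition config (M : machine) : eqType :=
  (state M * {ffun 'I_(extra M).+1 -> tape (aux M)})%type.

Definition moves (M : machine) (c : config M) :=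
  trans c.1 [ffun i => scan (c.2 i)].

Definition step (M : machine) : rel (config M) := fun c d =>
  [exists tr in moves c, d == (tr.1, [ffun i => act (tr.2 i) (c.2 i)])].

Definition halted (M : machine) (c : config M) : bool := moves c == set0.

Definition init (M : machine) (w : word) : config M :=
  (start M,
   [ffun i => ([::], if i == ord0 then [seq Some (inl b) | b <- w] else [::])]).

(* The bits from the head rightwards, up to the first cell not holding a bit. *)
Fixpoint read_bits (G : finType) (r : seq (symbol G)) : word :=
  if r is Some (inl b) :: r' then b :: read_bits r' else [::].

Definition output (M : machine) (c : config M) : word :=
  read_bits (c.2 ord0).2.

(* Every computation of [M] on [w], on every nondeterministic branch, makes at
   most [n] steps. *)
Definition runs_within (M : machine) (w : word) (n : nat) : Prop :=
  forall cs, path (@step M) (init M w) cs -> size cs <= n.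

Definition accepts (M : machine) (w : word) : Prop :=
  exists cs, [/\ path (@step M) (init M w) cs, halted (last (init M w) cs)
               & (last (init M w) cs).1 \in accepting M].

Definition computes (M : machine) (w v : word) : Prop :=
  exists cs, [/\ path (@step M) (init M w) cs, halted (last (init M w) cs)
               & output (last (init M w) cs) = v].

Definition decides_in_polytime (M : machine) (L : language) : Prop :=
  (exists p : {poly nat}, forall w, runs_within M w p.[size w]%R) /\
  forall w, L w <-> accepts M w.

Definition NP (L : language) : Prop :=
  exists M : machine, decides_in_polytime M L.

Definition P (L : language) : Prop :=
  exists2 M : machine, deterministic M & decides_in_polytime M L.

(* A search problem is a relation between inputs and admissible answers. Only
   the inputs having an answer are considered instances of the problem. *)
Definition solvable_in_polytime (R : word -> word -> Prop) : Prop :=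
  exists (M : machine) (p : {poly nat}), deterministic M /\
    forall w, (exists v, R w v) ->
      runs_within M w p.[size w]%R /\ exists2 v, R w v & computes M w v.

Definition polytime_computable (f : word -> word) : Prop :=
  solvable_in_polytime (fun w v => v = f w).

Definition reducible (L1 L2 : language) : Prop :=
  exists2 f, polytime_computable f & forall w, L1 w <-> L2 (f w).

Definition NP_hard (L : language) : Prop :=
  forall L', NP L' -> reducible L' L.

(* The data of an instance are rational, so that it can be given to a machine;
   numerators and denominators are encoded in binary below. *)
Record instance := Instance {
  experts : nat;
  rounds : nat;
  team_size : nat;
  prediction : 'M[rat]_(experts, rounds);
  outcome : 'rV[rat]_rounds;
  rounds_gt0 : 0 < rounds;
  team_size_bounds : 0 < team_size <= experts
}.

Definition squared_error (I : instance) (S : {set 'I_(experts I)}) : rat :=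
  (\sum_(t < rounds I)
     ((#|S|%:R)^-1 * (\sum_(i in S) prediction I i t) - outcome I ord0 t) ^+ 2)%R.

Definition optimal_team (I : instance) (S : {set 'I_(experts I)}) : Prop :=
  #|S| = team_size I /\
  forall S' : {set 'I_(experts I)}, #|S'| = team_size I ->
    (squared_error S <= squared_error S')%R.

Lemma optimal_team_exists (I : instance) :
  exists S : {set 'I_(experts I)}, optimal_team S.
Proof.
have /andP[_ le_m] := team_size_bounds I.
have [S0 S0P] : exists S0 : {set 'I_(experts I)}, #|S0| == team_size I.
  rewrite -[X in _ <= X]card_ord -cardsT in le_m.
  have : 0 < #|[set S : {set 'I_(experts I)} |
                (S \subset setT) && (#|S| == team_size I)]|.
    by rewrite cards_draws bin_gt0.
  by case/card_gt0P => S; rewrite inE => /andP[_]; exists S.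
case: (arg_minP (P := fun S : {set _} => #|S| == team_size I)
                (@squared_error I) S0P) => S /eqP SP Smin.
by exists S; split=> // S' /eqP; apply: Smin.
Qed.

(* Self-delimiting: each bit is preceded by [true], and [false] ends the word. *)
Definition code_word (w : word) : word :=
  flatten [seq [:: true; b] | b <- w] ++ [:: false].

(* Binary digits, least significant first. *)
Definition code_nat (n : nat) : word :=
  code_word (mkseq (fun i => odd (n %/ 2 ^ i)) (up_log 2 n.+1)).

Definition code_rat (a : rat) : word :=
  (numq a < 0)%R :: code_nat `|numq a|%N ++ code_nat `|denq a|%N.

Definition code_instance (I : instance) : word :=
  code_nat (experts I) ++ code_nat (rounds I) ++ code_nat (team_size I) ++
  flatten [seq code_rat (prediction I i t)
          | i <- enum 'I_(experts I), t <- enum 'I_(rounds I)] ++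
  flatten [seq code_rat (outcome I ord0 t) | t <- enum 'I_(rounds I)].

Definition code_team (n : nat) (S : {set 'I_n}) : word :=
  [seq i \in S | i <- enum 'I_n].

Definition team_selection : word -> word -> Prop := fun w v =>
  exists (I : instance) (S : {set 'I_(experts I)}),
    [/\ w = code_instance I, v = code_team S & optimal_team S].

(* The decision version, with a rational bound [b] on the error. *)
Definition team_selection_decision : language := fun w =>
  exists (I : instance) (b : rat),
    w = code_instance I ++ code_rat b /\
    exists2 S : {set 'I_(experts I)},
      #|S| = team_size I & (squared_error S <= b)%R.

Lemma code_word_inj w1 w2 u1 u2 :
  code_word w1 ++ u1 = code_word w2 ++ u2 -> w1 = w2 /\ u1 = u2.
Proof.
rewrite /code_word; elim: w1 w2 => [|b w1 IH] [|b2 w2] //=; first by case.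
by case=> -> /IH[-> ->].
Qed.

Lemma code_nat_inj n1 n2 u1 u2 :
  code_nat n1 ++ u1 = code_nat n2 ++ u2 -> n1 = n2 /\ u1 = u2.
Proof.
move=> /code_word_inj[+ ->]; pose val := foldr (fun (b : bool) v => b + v.*2) 0.
have valK l n : n < 2 ^ l -> val (mkseq (fun i => odd (n %/ 2 ^ i)) l) = n.
  elim: l n => [|l IH] n /=; first by case: n.
  move=> lt_n; rewrite divn1 -[1]addn0 iotaDl -map_comp.
  rewrite (eq_map (g := fun i => odd (n./2 %/ 2 ^ i))); last first.
    by move=> i /=; rewrite expnD divnMA divn2.
  rewrite -/(mkseq _ l) -/(val _) IH ?odd_double_half//.
  by rewrite ltn_half_double -muln2 mulnC -expnS.
by move=> /(congr1 val); rewrite !valK ?up_logP.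
Qed.

Lemma code_rat_inj a1 a2 u1 u2 :
  code_rat a1 ++ u1 = code_rat a2 ++ u2 -> a1 = a2 /\ u1 = u2.
Proof.
rewrite /code_rat !cat_cons -!(catA (code_nat _)) => /eqP; rewrite eqseq_cons => /andP[/eqP sgE].
move=> /eqP/code_nat_inj[numE /code_nat_inj[denE ->]].
split=> //; rewrite -(divq_num_den a1) -(divq_num_den a2).
rewrite (intEsign (numq a1)) (intEsign (numq a2)) sgE numE.
by rewrite -(absz_denq a1) -(absz_denq a2) denE.
Qed.

Lemma code_rats_inj T (s : seq T) (f1 f2 : T -> rat) u1 u2 :
  flatten [seq code_rat (f1 i) | i <- s] ++ u1 =
  flatten [seq code_rat (f2 i) | i <- s] ++ u2 ->
  [seq f1 i | i <- s] = [seq f2 i | i <- s] /\ u1 = u2.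
Proof.
have flE a r : flatten (a :: r) = a ++ flatten r :> word by [].
elim: s => [//|i s IH]; rewrite !map_cons !flE -!(catA (code_rat _)) => /code_rat_inj[-> /IH[-> ->]].
by [].
Qed.

Lemma code_instance_inj I1 I2 u1 u2 :
  code_instance I1 ++ u1 = code_instance I2 ++ u2 -> I1 = I2 /\ u1 = u2.
Proof.
case: I1 I2 => [n1 k1 m1 y1 x1 k1P m1P] [n2 k2 m2 y2 x2 k2P m2P].
rewrite /code_instance -!(catA (code_nat _)) -![(flatten _ ++ flatten _) ++ _]catA.
move=> /code_nat_inj[nE /code_nat_inj[kE /code_nat_inj[mE]]].
move: nE kE mE => /= ? ? ?; subst n2 k2 m2.
pose E := [seq (i, t) | i <- enum 'I_n1, t <- enum 'I_k1].
have EE (y : 'M[rat]_(n1, k1)) :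
    [seq code_rat (y i t) | i <- enum 'I_n1, t <- enum 'I_k1] =
    [seq code_rat (y p.1 p.2) | p <- E] by rewrite map_allpairs.
rewrite !EE => /(code_rats_inj (f1 := fun p => y1 p.1 p.2)
                               (f2 := fun p => y2 p.1 p.2))[yE].
move=> /(code_rats_inj (f1 := x1 ord0) (f2 := x2 ord0))[xE ->].
have -> : y1 = y2.
  apply/matrixP => i t; have /eq_in_map/(_ (i, t)) := yE; apply.
  by apply/allpairsP; exists (i, t); rewrite !mem_enum.
have -> : x1 = x2.
  by apply/rowP => t; have /eq_in_map/(_ t) := xE; apply; rewrite mem_enum.
by rewrite (bool_irrelevance k1P k2P) (bool_irrelevance m1P m2P).
Qed.

Lemma code_team_inj n : injective (@code_team n).
Proof.
move=> S1 S2 /eq_in_map SE; apply/setP => i.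
by apply: SE; rewrite mem_enum.
Qed.

(* Main.v *)
Require Import Defs.
From Stdlib Require Import FunctionalExtensionality.
From mathcomp Require Import all_boot all_order all_algebra zify.

(* The computations of a nondeterministic machine are encoded directly. An expert
   stands for a transition made at a given time, or for what happens at one cell of
   one tape at a given time; a round states a conservation law, that the states,
   symbols, heads and head actions used at a time are those provided at the previous
   one. With predictions in {0, 2, -2} and outcomes 0, a team has error 0 exactly
   when its experts balance in every round. One expert supplies the initial
   configuration: without it no other expert of a computation can be balanced. Zero
   experts, one fewer than the team size, fill up the team, so that a team of error 0
   contains the initial expert and encodes an accepting computation.

   One more expert has prediction 1 in one round and 0 in the others. With zero
   experts it forms a team that is worse than the exact ones but better than every
   inexact team without it, so that one bit of an optimal team tells whether the
   machine accepts.

   The instance is written by nested loops over tapes of polynomial length; two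
   loop variables are compared by scanning a tape marked near its origin whose
   head is at their difference. *)

Set Implicit Arguments.
Unset Strict Implicit.
Unset Printing Implicit Defensive.

Import Order.TTheory GRing.Theory Num.Theory.

(** * Tapes and machines *)

(** A round constrains the team by one linear equation in its indicator. The numbers of selected
    experts that consume and that produce a given token are linear in it too, so a computation,
    where each step locally replaces tokens, can be imposed by such equations. All compared teams
    have the same size [m] and all outcomes are 0, so the error is [m^-2] times the sum over the
    rounds of the squared sums of entries, and averaging plays no part in comparisons. An imbalance
    gives a nonzero even sum, hence a square of at least 4, while the signal costs 1: this is why
    the entries are [2] and [-2]. The signal answers an obstacle of the search version: a solver
    returns a team and not its error, and computing the error would need rational arithmetic on a
    machine; reading one bit does not. Times and positions range over one line, and experts and
    rounds share the same kinds, so [m] rounds, [2 * m] experts and a team of [m] members are all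
    written from one counter. *)

Definition atape (G : finType) := ((int -> symbol G) * int)%type.

Definition ascan (G : finType) (a : atape G) : symbol G := a.1 a.2.

Definition offset (d : move) : int :=
  match d with None => 0%R | Some true => 1%R | Some false => (-1)%R end.

Definition aact (G : finType) (am : symbol G * move) (a : atape G) : atape G :=
  (fun z => if z == a.2 then am.1 else a.1 z, (a.2 + offset am.2)%R).

(** Absolute coordinates replace the list pairs of [tape], so that moves become translations and
    distances travelled can be measured. Only cells relative to the head are compared, which makes
    the origin of the coordinates free. *)
Definition represents (G : finType) (t : tape G) (a : atape G) : Prop :=
  forall k : nat, nth None t.2 k = a.1 (a.2 + k%:Z)%R /\
                  nth None t.1 k = a.1 (a.2 - k.+1%:Z)%R.

Lemma aact_keep (G : finType) (a : atape G) : aact (ascan a, None) a = a.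
Proof.
case: a => f x; rewrite /aact /= addr0; congr (_, _).
by apply: functional_extensionality => z; case: eqP => [->|].
Qed.

Lemma represents_scan (G : finType) (t : tape G) a :
  represents t a -> scan t = ascan a.
Proof. by move=> /(_ 0)[+ _]; rewrite nth0 addr0. Qed.

Lemma represents_act (G : finType) am (t : tape G) a :
  represents t a -> represents (act am t) (aact am a).
Proof.
case: t a am => l r [f x] [s d] ra k; rewrite /act /aact /=.
have ral k' := (ra k').2; have rar k' := (ra k').1; move: ral rar => /= ral rar.
case: d => [[]|] /=.
- split; first by rewrite nth_behead rar ifF; [congr f|apply/eqP]; lia.
  case: k => [|k] /=; first by rewrite ifT //; apply/eqP; lia.
  by rewrite ral ifF; [congr f|apply/eqP]; lia.
- split; last by rewrite nth_behead ral ifF; [congr f|apply/eqP]; lia.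
  case: k => [|[|k]] /=.
  + by rewrite -nth0 ral ifF; [congr f|apply/eqP]; lia.
  + by rewrite ifT //; apply/eqP; lia.
  + by rewrite nth_behead rar ifF; [congr f|apply/eqP]; lia.
- split; last by rewrite ral ifF; [congr f|apply/eqP]; lia.
  case: k => [|k] /=; first by rewrite ifT //; apply/eqP; lia.
  by rewrite nth_behead rar ifF; [congr f|apply/eqP]; lia.
Qed.

Definition segment (G : finType) (b : int) (s : seq (symbol G)) : int -> symbol G :=
  fun z => if (z - b)%R is Posz i then nth None s i else None.

Lemma segment_nth (G : finType) b (s : seq (symbol G)) (i : nat) :
  segment b s (b + i%:Z)%R = nth None s i.
Proof. by rewrite /segment addrC addKr. Qed.

Lemma segment_lt (G : finType) b (s : seq (symbol G)) z :
  (z < b)%R -> segment b s z = None.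
Proof. by rewrite /segment => ltzb; case E: (z - b)%R => //; lia. Qed.

Lemma represents_segment (G : finType) b (s : seq (symbol G)) :
  represents ([::], s) (segment b s, b).
Proof.
move=> k /=; rewrite segment_nth segment_lt ?nth_nil//; lia.
Qed.

Lemma read_bits_segment (G : finType) (t : tape G) b (s : word) :
  represents t (segment b [seq Some (inl x) | x <- s], b) -> read_bits t.2 = s.
Proof.
move=> rt; have {}rt k : nth None t.2 k = nth None [seq Some (inl x) | x <- s] k.
  by rewrite (rt k).1 /= segment_nth.
elim: s t.2 rt => [|x s IH] r rt.
  by case: r rt => [|y r] // /(_ 0) /= ->.
case: r rt => [/(_ 0)//|y r] rt /=; move: (rt 0) => /= ->.
by rewrite IH // => k; apply: (rt k.+1).
Qed.

Section NamedTapes.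

(* Tapes are named by [option X]; [None] is the input and output tape. *)
Variables (G X Q : finType).

Definition view := option X -> symbol G.
Definition actions := option X -> symbol G * move.
Definition atapes := option X -> atape G.

Variable delta : Q -> view -> option (Q * actions).
Variables (q0 : Q) (acc : {set Q}).

Definition tape_index (x : option X) : 'I_#|X|.+1 :=
  if x is Some y then lift ord0 (enum_rank y) else ord0.
Definition tape_name (i : 'I_#|X|.+1) : option X := omap enum_val (unlift ord0 i).

Lemma tape_indexK : cancel tape_index tape_name.
Proof.
by case=> [x|]; rewrite /tape_name /= ?unlift_none ?liftK /= ?enum_rankK.
Qed.

Lemma tape_nameK : cancel tape_name tape_index.
Proof.
move=> i; rewrite /tape_name; case: unliftP => [j ->|->] //=.
by rewrite enum_valK.
Qed.

Definition named_machine : machine :=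
  @Machine #|X| Q G q0 acc (fun q a =>
    if delta q (fun x => a (tape_index x)) is Some (q', am)
    then [set (q', [ffun i => am (tape_name i)])] else set0).

Definition see (T : atapes) : view := fun x => ascan (T x).
Definition apply_acts (am : actions) (T : atapes) : atapes :=
  fun x => aact (am x) (T x).

Definition nstep (c : Q * atapes) : option (Q * atapes) :=
  omap (fun d => (d.1, apply_acts d.2 c.2)) (delta c.1 (see c.2)).

Fixpoint nsteps k (c : Q * atapes) : option (Q * atapes) :=
  if k is k'.+1 then obind (nsteps k') (nstep c) else Some c.

Lemma nsteps_add k1 k2 c : nsteps (k1 + k2) c = obind (nsteps k2) (nsteps k1 c).
Proof. by elim: k1 c => [|k IH] c //=; case: (nstep c) => //=. Qed.

Definition crepresents (c : config named_machine) (d : Q * atapes) : Prop :=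
  c.1 = d.1 /\ forall i, represents (c.2 i) (d.2 (tape_name i)).

Lemma named_deterministic : deterministic named_machine.
Proof.
move=> q a /=; case: (delta _ _) => [[q' am]|]; by rewrite ?cards1 ?cards0.
Qed.

Lemma crepresents_see c d : crepresents c d ->
  (fun x => [ffun i => scan (c.2 i)] (tape_index x)) = see d.2.
Proof.
case=> _ rT; apply: functional_extensionality => x.
by rewrite ffunE (represents_scan (rT _)) tape_indexK.
Qed.

Lemma nstep_halted c d : crepresents c d -> (nstep d = None <-> halted c).
Proof.
move=> rcd; rewrite /halted /moves /= (crepresents_see rcd) rcd.1 /nstep.
case: (delta _ _) => [[q am]|] /=; last by split.
by split=> // /eqP/setP/(_ (q, [ffun i => am (tape_name i)])); rewrite !inE eqxx.
Qed.

Lemma nstep_step c d d' : crepresents c d -> nstep d = Some d' ->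
  exists2 c', crepresents c' d' & forall e, step c e = (e == c').
Proof.
move=> rcd; rewrite /nstep; case E: (delta _ _) => [[q am]|] //= [<-].
exists (q, [ffun i => act (am (tape_name i)) (c.2 i)]).
  split=> //= i; rewrite ffunE; apply: represents_act; apply: rcd.2.
move=> e; apply/existsP/eqP => [[tr]|->].
  rewrite /moves /= (crepresents_see rcd) rcd.1 E !inE => /andP[/eqP-> /eqP->] /=.
  by congr (_, _); apply/ffunP => i; rewrite !ffunE.
exists (q, [ffun i => am (tape_name i)]).
rewrite /moves /= (crepresents_see rcd) rcd.1 E !inE eqxx /=.
by apply/eqP; congr (_, _); apply/ffunP => i; rewrite !ffunE.
Qed.

Definition ainit (w : word) : atapes := fun x =>
  (segment 0%R (if x is None then [seq Some (inl b) | b <- w] else [::]), 0%R).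

Lemma crepresents_init w : crepresents (init named_machine w) (q0, ainit w).
Proof.
split=> //= i; rewrite ffunE /ainit.
have -> : (i == ord0) = (tape_name i == None).
  by rewrite -(can_eq tape_indexK) tape_nameK.
by case: (tape_name i) => [x|] /=; apply: represents_segment.
Qed.

(* The machine is deterministic, so one halting run determines all paths. *)
Lemma named_machine_run k w d :
  nsteps k (q0, ainit w) = Some d -> nstep d = None ->
  runs_within named_machine w k /\
  exists c, [/\ crepresents c d,
    exists cs, [/\ path (@step named_machine) (init named_machine w) cs,
                   halted c & last (init named_machine w) cs = c] &
    forall cs, path (@step named_machine) (init named_machine w) cs ->
      halted (last (init named_machine w) cs) ->
      last (init named_machine w) cs = c].
Proof.
rewrite /runs_within; move: (crepresents_init w).
move: (init _ w) (q0, ainit w) => c e rce + hd.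
elim: k c e rce => [|k IH] c e rce /=.
  case=> ed; rewrite {}ed in rce *.
  have hc : halted c by apply/(nstep_halted rce).
  have nil cs : path (@step named_machine) c cs -> cs = [::].
    case: cs => // c' cs /= /andP[/existsP[tr /andP[]]].
    by move: hc; rewrite /halted => /eqP->; rewrite inE.
  split; first by move=> cs /nil->.
  exists c; split=> //; first by exists [::].
  by move=> cs /nil->.
case E: (nstep e) => [e'|] //= run_e.
have [c' rce' stepE] := nstep_step rce E.
have [hr [cf [rcf [cs [pcs hcf lcs]] uniq]]] := IH _ _ rce' run_e.
split.
  by move=> [|c2 cs2] //= /andP[]; rewrite stepE => /eqP-> /hr.
exists cf; split=> //.
  by exists (c' :: cs); split=> //=; rewrite stepE eqxx.
move=> [|c2 cs2] /=.
  by move=> _ /(nstep_halted rce); rewrite E.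
by rewrite stepE => /andP[/eqP-> pcs2]; apply: uniq.
Qed.

End NamedTapes.

(** * A structured language of machines *)

Section Programs.

Variables (G X : finType).
Notation view := (view G X).
Notation actions := (actions G X).
Notation atapes := (atapes G X).

Inductive prog :=
| Act of view -> actions
| Seq of prog & prog
| If of view -> bool & prog & prog
| While of view -> bool & prog.

Fixpoint pstate (p : prog) : finType :=
  match p with
  | Act _ => unit : finType
  | Seq p1 p2 => (pstate p1 + pstate p2)%type : finType
  | If _ p1 p2 => option (pstate p1 + pstate p2)%type : finType
  | While _ p1 => option (pstate p1) : finType
  end.

Fixpoint pstart (p : prog) : pstate p :=
  match p with
  | Act _ => tt
  | Seq p1 _ => inl (pstart p1)
  | If _ _ _ => None
  | While _ _ => None
  end.

Definition keep (v : view) : actions := fun x => (v x, None).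

(* The next state, [None] when the program terminates with this step. *)
Fixpoint pnext (p : prog) : pstate p -> view -> option (pstate p) * actions :=
  match p with
  | Act f => fun _ v => (None, f v)
  | Seq p1 p2 => fun s v =>
      match s with
      | inl s1 => let d := pnext s1 v in
          (Some (if d.1 is Some s1' then inl s1' else inr (pstart p2)), d.2)
      | inr s2 => let d := pnext s2 v in (omap inr d.1, d.2)
      end
  | If b p1 p2 => fun s v =>
      match s with
      | None =>
          (Some (Some (if b v then inl (pstart p1) else inr (pstart p2))), keep v)
      | Some (inl s1) => let d := pnext s1 v in (omap (Some \o inl) d.1, d.2)
      | Some (inr s2) => let d := pnext s2 v in (omap (Some \o inr) d.1, d.2)
      end
  | While b p1 => fun s v =>
      match s with
      | None => (if b v then Some (Some (pstart p1)) else None, keep v)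
      | Some s1 => let d := pnext s1 v in (Some d.1, d.2)
      end
  end.

Inductive exec : prog -> atapes -> nat -> atapes -> Prop :=
| ExecAct f T : exec (Act f) T 1 (apply_acts (f (see T)) T)
| ExecSeq p1 p2 T1 k1 T2 k2 T3 :
    exec p1 T1 k1 T2 -> exec p2 T2 k2 T3 -> exec (Seq p1 p2) T1 (k1 + k2) T3
| ExecIf b p1 p2 T k T' :
    exec (if b (see T) then p1 else p2) T k T' -> exec (If b p1 p2) T k.+1 T'
| ExecDone (b : view -> bool) p T : ~~ b (see T) -> exec (While b p) T 1 T
| ExecLoop (b : view -> bool) p T1 k1 T2 k2 T3 : b (see T1) ->
    exec p T1 k1 T2 -> exec (While b p) T2 k2 T3 ->
    exec (While b p) T1 (k1 + k2).+1 T3.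

(** [exec] follows the syntax of a program; this relation follows its control states, as the machine
    does, and links the two. *)
Inductive psteps (p : prog) : pstate p -> atapes -> nat -> atapes -> Prop :=
| PLast s T am : pnext s (see T) = (None, am) -> psteps s T 1 (apply_acts am T)
| PMore s T s' am k T' : pnext s (see T) = (Some s', am) ->
    psteps s' (apply_acts am T) k T' -> psteps s T k.+1 T'.

Lemma apply_keep T : apply_acts (keep (see T)) T = T.
Proof. by apply: functional_extensionality => x; apply: aact_keep. Qed.

Lemma psteps_lift p q (lift : pstate p -> pstate q) :
  (forall s v, pnext (lift s) v = (omap lift (pnext s v).1, (pnext s v).2)) ->
  forall s T k T', psteps s T k T' -> psteps (lift s) T k T'.
Proof.
move=> liftE s T k T'; elim=> {s T k T'} => [s T am E|s T s' am k T' E _ IH].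
  by apply: PLast; rewrite liftE E.
by apply: PMore IH; rewrite liftE E.
Qed.

Lemma psteps_seq p1 p2 (s : pstate p1) T1 k1 T2 k2 T3 :
  psteps s T1 k1 T2 -> psteps (pstart p2) T2 k2 T3 ->
  psteps (p := Seq p1 p2) (inl s) T1 (k1 + k2) T3.
Proof.
move=> run1 /(psteps_lift (q := Seq p1 p2) (lift := inr) (fun _ _ => erefl)) run2.
elim: run1 run2 => {s T1 k1 T2} => [s T am E|s T s' am k T' E _ IH] run2.
  by rewrite add1n; apply: PMore run2; rewrite /= E.
by rewrite addSn; apply: PMore (IH run2); rewrite /= E.
Qed.

Lemma psteps_loop b p (s : pstate p) T1 k1 T2 k2 T3 :
  psteps s T1 k1 T2 -> psteps (p := While b p) None T2 k2 T3 ->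
  psteps (p := While b p) (Some s) T1 (k1 + k2) T3.
Proof.
move=> run1 run2; elim: run1 run2 => {s T1 k1 T2} => [s T am E|s T s' am k T' E _ IH] run2.
  by rewrite add1n; apply: PMore run2; rewrite /= E.
by rewrite addSn; apply: PMore (IH run2); rewrite /= E.
Qed.

Lemma exec_psteps p T k T' : exec p T k T' -> psteps (pstart p) T k T'.
Proof.
elim=> {p T k T'}.
- by move=> f T; apply: PLast.
- by move=> *; apply: psteps_seq; eassumption.
- move=> b p1 p2 T k T' _ IH.
  apply: (@PMore (If b p1 p2) None T _ (keep (see T)) k T' (erefl _)).
  rewrite apply_keep; case: (b _) IH => IH.
    exact: (psteps_lift (q := If b p1 p2) (lift := Some \o inl)).
  exact: (psteps_lift (q := If b p1 p2) (lift := Some \o inr)).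
- move=> b p T nb; rewrite -{2}(apply_keep T).
  by apply: PLast => /=; rewrite (negbTE nb).
- move=> b p T1 k1 T2 k2 T3 bT _ IH1 _ IH2.
  apply: (@PMore (While b p) None _ (Some (pstart p)) (keep (see T1))).

    by rewrite /= bT.
  by rewrite apply_keep; apply: psteps_loop IH1 IH2.
Qed.

Lemma offset_le1 d : `|offset d|%N <= 1.
Proof. by case: d => [[]|]. Qed.

Lemma exec_head p T k T' x : exec p T k T' -> `|(T' x).2 - (T x).2|%N <= k.
Proof.
elim=> {p T k T'} //=.
- move=> f T; rewrite /apply_acts /aact /=; have := offset_le1 (f (see T) x).2.
  by move: (offset _) (T x).2 => a b; rewrite addrAC subrr add0r.
- by move=> p1 p2 T1 k1 T2 k2 T3 _ + _; lia.
- by move=> b p1 p2 T k T' _; lia.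
- by move=> b p T _; lia.
- by move=> b p T1 k1 T2 k2 T3 _ _ + _; lia.
Qed.

Section Then.

Variables (p : prog) (R : finType) (r0 : R).
Variable rest : R -> view -> option (R * actions).

(** The continuation is a raw transition function and not a program, because it can be an arbitrary
    given machine, such as the simulated solver. *)
Definition then_delta (s : (pstate p + R)%type) (v : view) :
    option ((pstate p + R)%type * actions) :=
  match s with
  | inl s1 => let d := pnext s1 v in
      Some (if d.1 is Some s1' then inl s1' else inr r0, d.2)
  | inr r => omap (fun d => (inr d.1, d.2)) (rest r v)
  end.

Lemma exec_nsteps T k T' : exec p T k T' ->
  nsteps then_delta k (inl (pstart p), T) = Some (inr r0, T').
Proof.
move=> /exec_psteps; elim=> {T k T'} => [s T am E|s T s' am k T' E _ IH].
  by rewrite /= /nstep /= E.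
by rewrite /= /nstep /= E /= -IH.
Qed.

End Then.

End Programs.

(** * Time bounds for loops driven by tapes *)

Section Loops.

Variables (G X : finType).
Notation view := (view G X).
Notation atapes := (atapes G X).
Notation prog := (prog G X).

Definition runs (p : prog) (T : atapes) (n : nat) (T' : atapes) : Prop :=
  exists2 k, exec p T k T' & k <= n.

Lemma runs_le p T n n' T' : n <= n' -> runs p T n T' -> runs p T n' T'.
Proof. by move=> le_n [k ex le_k]; exists k => //; apply: leq_trans le_n. Qed.

Lemma runs_act f T : runs (Act f) T 1 (apply_acts (f (see T)) T).
Proof. by exists 1 => //; apply: ExecAct. Qed.

Lemma runs_seq p1 p2 T1 n1 T2 n2 T3 :
  runs p1 T1 n1 T2 -> runs p2 T2 n2 T3 -> runs (Seq p1 p2) T1 (n1 + n2) T3.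
Proof.
move=> [k1 ex1 le1] [k2 ex2 le2]; exists (k1 + k2); last exact: leq_add.
exact: ExecSeq ex2.
Qed.

Lemma runs_if b p1 p2 T n T' :
  runs (if b (see T) then p1 else p2) T n T' -> runs (If b p1 p2) T n.+1 T'.
Proof. by move=> [k ex le]; exists k.+1 => //; apply: ExecIf. Qed.

Lemma runs_done (b : view -> bool) p T : ~~ b (see T) -> runs (While b p) T 1 T.
Proof. by exists 1 => //; apply: ExecDone. Qed.

Lemma runs_loop (b : view -> bool) p T1 n1 T2 n2 T3 : b (see T1) ->
  runs p T1 n1 T2 -> runs (While b p) T2 n2 T3 ->
  runs (While b p) T1 (n1 + n2).+1 T3.
Proof.
move=> bT [k1 ex1 le1] [k2 ex2 le2]; exists (k1 + k2).+1.
  exact: ExecLoop ex2.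
by rewrite ltnS leq_add.
Qed.

Definition seqs (ps : seq prog) : prog := foldr (@Seq G X) (Act (@keep G X)) ps.

Lemma runs_skip T : runs (seqs [::]) T 1 T.
Proof. by have := runs_act (@keep G X) T; rewrite apply_keep. Qed.

(* A mover tells for each tape how its head follows one step of a loop. *)
Definition mover := option X -> move.

Definition shift (mu : mover) (n : int) (T : atapes) : atapes :=
  fun x => ((T x).1, (T x).2 + offset (mu x) * n)%R.

Definition advance (mu : mover) : prog := Act (fun v x => (v x, mu x)).
Definition back (mu : mover) : mover := fun x => omap negb (mu x).
Definition nonblank (x : option X) (v : view) : bool := v x != None.

Lemma shift0 mu T : shift mu 0 T = T.
Proof.
apply: functional_extensionality => x; rewrite /shift mulr0 addr0.
by case: (T x).
Qed.

Lemma shiftD mu a b T : shift mu a (shift mu b T) = shift mu (a + b)%R T.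
Proof.
by apply: functional_extensionality => x; rewrite /shift /= mulrDr -addrA (addrC (_ * a)%R).
Qed.

Lemma acts_mover mu T :
  apply_acts (fun x => (see T x, mu x)) T = shift mu 1 T.
Proof.
apply: functional_extensionality => x.
rewrite -[in RHS](apply_keep T) /apply_acts /shift /aact /= mulr1 addr0.
by [].
Qed.

Lemma runs_advance mu T : runs (advance mu) T 1 (shift mu 1 T).
Proof. by rewrite -acts_mover; apply: runs_act. Qed.

Lemma runs_back mu T : runs (advance (back mu)) T 1 (shift mu (-1) T).
Proof.
have -> : shift mu (-1) T = shift (back mu) 1 T; last exact: (runs_advance (back mu) T).
apply: functional_extensionality => x; rewrite /shift /back.
by case: (mu x) => [[]|].
Qed.

(** The head starts just past a nonblank run, possibly empty. The first step back leaves that cell,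
    and the last step forward leaves the blank cell that stopped the loop. All heads followed by
    [mu] move together. *)
Definition rewind mu x : prog :=
  Seq (advance (back mu))
      (Seq (While (nonblank x) (advance (back mu))) (advance mu)).

Lemma runs_rewind mu x T (z : int) (p : nat) : mu x = Some true ->
  (forall i, i < p -> (T x).1 (z + i%:Z)%R != None) -> (T x).1 (z - 1)%R = None ->
  (T x).2 = (z + p%:Z)%R -> runs (rewind mu x) T (2 * p + 3) (shift mu (- p%:Z) T).
Proof.
move=> mux ne_f f_end Tx.
have loop : runs (While (nonblank x) (advance (back mu))) (shift mu (-1) T)
                 (2 * p + 1) (shift mu (- p%:Z - 1) T).
  elim: p T ne_f f_end Tx => [|p IH] T ne_f f_end Tx.
    rewrite oppr0 add0r; apply: runs_done; apply/negPn/eqP.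
    by rewrite /see /ascan /= mux mul1r Tx addr0.
  have -> : (- p.+1%:Z - 1 = (- p%:Z - 1) + -1)%R by lia.
  rewrite mulnS addnAC; rewrite -shiftD.
  apply: (@runs_le _ _ (1 + (2 * p + 1)).+1); first by lia.
  apply: runs_loop (runs_back _ _) _.
    rewrite /nonblank /see /ascan /= mux mul1r Tx.
    have -> : (z + p.+1%:Z + -1 = z + p%:Z)%R by lia.
    exact: ne_f.
  apply: IH => //=; first by move=> i ltip; apply: ne_f; apply: ltnW.
  by rewrite Tx mux mul1r; lia.
apply: (@runs_le _ _ (1 + ((2 * p + 1) + 1))); first by lia.
apply: runs_seq (runs_back _ _) (runs_seq loop _).
have := runs_advance mu (shift mu (- p%:Z - 1) T); rewrite shiftD.
by have -> : (1 + (- p%:Z - 1) = - p%:Z)%R by lia.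
Qed.

Definition For mu x body : prog :=
  Seq (While (nonblank x) (Seq body (advance mu))) (rewind mu x).

(** [A i] describes the tapes after [i] iterations as if the heads followed by [mu] were back at
    their starting positions; the shift restores their true positions. Invariants of nested loops
    thus need not mention these heads, and rewinding cancels the shift. *)
Lemma runs_for mu x body (f : int -> symbol G) l c (A : nat -> atapes) :
  mu x = Some true ->
  (forall i, i < l -> f (Posz i) != None) -> f (Posz l) = None -> f (-1)%R = None ->
  (forall i, i <= l -> A i x = (f, 0%R)) ->
  (forall i, i < l -> runs body (shift mu (Posz i) (A i)) c (shift mu (Posz i) (A i.+1))) ->
  runs (For mu x body) (A 0) (l * (c + 4) + 4) (A l).
Proof.
move=> mux ne_f f_end f_start Ax runb.
have loop k : k <= l ->
    runs (While (nonblank x) (Seq body (advance mu)))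
         (shift mu (Posz (l - k)) (A (l - k))) (k * (c + 2) + 1) (shift mu (Posz l) (A l)).
  elim: k => [_|k IH ltkl].
    rewrite subn0; apply: runs_done; apply/negPn/eqP.
    by rewrite /see /ascan /= Ax // mux /= mul1r add0r.
  have ltl : l - k.+1 < l by lia.
  apply: (@runs_le _ _ ((c + 1) + (k * (c + 2) + 1)).+1); first by rewrite mulSn; lia.
  apply: runs_loop (runs_seq (runb _ ltl) (runs_advance _ _)) _.
    rewrite /nonblank /see /ascan /= Ax ?leq_subr// mux /= mul1r add0r.
    exact: ne_f.
  rewrite shiftD; have -> : (l - k.+1).+1 = l - k by lia.
  have -> : (1 + (Posz (l - k.+1)) = (Posz (l - k)))%R by lia.
  by apply: IH; apply: ltnW.
have := loop l (leqnn l); rewrite subnn shift0 => {}loop.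
apply: (@runs_le _ _ ((l * (c + 2) + 1) + (2 * l + 3))).
  by rewrite !mulnDr; lia.
apply: runs_seq loop _.
have {2}-> : A l = shift mu (- (Posz l)) (shift mu (Posz l) (A l)).
  by rewrite shiftD addNr shift0.
apply: (@runs_rewind _ _ _ 0%R) => //=; rewrite ?Ax //=.
by rewrite mux /= mul1r.
Qed.

End Loops.

Arguments advance {G X}.
Arguments nonblank {G X}.
Arguments rewind {G X}.
Arguments For {G X}.
Arguments seqs {G X}.

(** * Writing the instance *)

(* Is it the first cell, is it the cell of the first input symbol, and the input
   symbol. *)
Definition cell : finType := (bool * bool * option bool)%type.

Definition empty_cell : cell := (false, false, None).

(** The first cell is present even for an empty input, so that the origin is always marked. The two
    cells added at the end make the length at least [size w + 2], the base used in
    [poly_bounded]. *)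
Definition input_cells (w : word) : seq cell :=
  (false, true, ohead w) :: [seq (false, false, Some b) | b <- behead w]
    ++ [:: empty_cell; empty_cell].

(** Its cells number both the times and the positions. Cell 0, the only one flagged as first, stands
    for the initial time. A head that starts on the first input cell and makes at most as many steps
    as a margin is long stays on the line. *)
Definition line (d : nat) (w : word) : seq cell :=
  let margin := nseq (size (input_cells w) ^ d.+1) empty_cell in
  (true, false, None) :: margin ++ input_cells w ++ margin.

Lemma segment_nil (G : finType) b z : segment (G := G) b [::] z = None.
Proof. by rewrite /segment; case: (_ - _)%R => // i; rewrite nth_nil. Qed.

(** * Preparing the tapes that drive the loops *)

Section Setup.

Variables (d : nat) (Y GY : finType).

Definition gsym : finType := (cell + move + GY)%type.
(** A pair [(r, tp)] names a loop variable: of the experts for [r = false], of the rounds for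
    [r = true]; a time for [tp = false], a position for [tp = true]. Then come the difference tapes
    for times and positions, the counter, the copies of the input whose nested loops yield a power
    of its length, and the tapes [Y] kept blank for a simulated solver. *)
Definition tname : finType :=
  ((bool * bool) + bool + unit + 'I_d.+1 + Y)%type.

Notation sym := (symbol gsym).
Notation view := (view gsym tname).
Notation atapes := (atapes gsym tname).
Notation atape := (atape gsym).
Notation prog := (prog gsym tname).
Notation runs := (@runs gsym tname).
Notation mover := (mover tname).

Definition cellsym (c : cell) : sym := Some (inr (inl (inl c))).
Definition marksym (m : move) : sym := Some (inr (inl (inr m))).
Definition bitsym (b : bool) : sym := Some (inl b).

Definition varT (v : bool * bool) : option tname := Some (inl (inl (inl (inl v)))).
Definition diffT (tp : bool) : option tname := Some (inl (inl (inl (inr tp)))).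
Definition ctrT : option tname := Some (inl (inl (inr tt))).
Definition loopT (i : 'I_d.+1) : option tname := Some (inl (inr i)).

Definition blank : atape := (segment 0%R [::], 0%R).

Definition mk (loops : 'I_d.+1 -> atape) (vars : bool * bool -> atape)
    (diffs : bool -> atape) (ctr out : atape) : atapes := fun x =>
  match x with
  | None => out
  | Some (inl (inl (inl (inl v)))) => vars v
  | Some (inl (inl (inl (inr tp)))) => diffs tp
  | Some (inl (inl (inr tt))) => ctr
  | Some (inl (inr i)) => loops i
  | Some (inr _) => blank
  end.

Lemma eq_atapes (T T' : atapes) :
  (forall i, T (loopT i) = T' (loopT i)) -> (forall v, T (varT v) = T' (varT v)) ->
  (forall tp, T (diffT tp) = T' (diffT tp)) -> T ctrT = T' ctrT ->
  T None = T' None -> (forall y, T (Some (inr y)) = T' (Some (inr y))) -> T = T'.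
Proof.
move=> eqL eqV eqD eqC eqO eqY; apply: functional_extensionality.
by case=> [[[[[v|tp]|[]]|i]|y]|//]; [apply: eqV|apply: eqD|apply: eqC|apply: eqL|apply: eqY].
Qed.

Definition write_diffs (s : sym) (m : move) : prog := Act (fun v x =>
  if x is Some (inl (inl (inl (inr _)))) then (s, m) else (v x, None)).

(* A tape with these marks, scanned at the difference of two loop variables,
   lets a program compare them in one step. *)
Definition diffmark (z : int) : sym :=
  match z with
  | Posz 0 => marksym None
  | Posz 1 => marksym (Some true)
  | Negz 0 => marksym (Some false)
  | _ => None
  end.

Definition setup_diffs : prog :=
  Seq (write_diffs (marksym None) (Some true))
  (Seq (write_diffs (marksym (Some true)) (Some false))
  (Seq (write_diffs (marksym None) (Some false))
       (write_diffs (marksym (Some false)) (Some true)))).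

Lemma runs_write_diffs s m loops vars a ctr out :
  runs (write_diffs s m) (mk loops vars (fun _ => a) ctr out) 1
       (mk loops vars (fun _ => aact (s, m) a) ctr out).
Proof.
set T := mk _ _ _ _ _.
rewrite (_ : mk _ _ _ _ _ = apply_acts (fun x =>
  if x is Some (inl (inl (inl (inr _)))) then (s, m) else (see T x, None)) T).
  exact: runs_act.
by apply: eq_atapes => *; rewrite /apply_acts ?aact_keep.
Qed.

Lemma runs_setup_diffs loops vars ctr out :
  runs setup_diffs (mk loops vars (fun _ => blank) ctr out) 4
       (mk loops vars (fun _ => (diffmark, 0%R)) ctr out).
Proof.
set s1 := marksym None; set s2 := marksym (Some true).
set s3 := marksym (Some false).
have -> : (diffmark, 0%R) =
    aact (s3, Some true) (aact (s1, Some false)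
      (aact (s2, Some false) (aact (s1, Some true) blank))).
  rewrite /aact /=; congr (_, _).
  apply: functional_extensionality => -[[|[|z]]|[|z]] //=; by rewrite segment_nil.
apply: (@runs_le _ _ _ _ (1 + (1 + (1 + 1)))) => //.
by do !apply: runs_seq; apply: runs_write_diffs.
Qed.

Definition bits (o : word) : seq sym := map bitsym o.
Definition cells (s : seq cell) : seq sym := map cellsym s.

Lemma size_bits o : size (bits o) = size o. Proof. exact: size_map. Qed.
Lemma size_cells o : size (cells o) = size o. Proof. exact: size_map. Qed.

Lemma segment_rcons (b : int) (s : seq sym) x :
  aact (x, Some true) (segment b s, b + (size s)%:Z)%R =
  (segment b (rcons s x), b + (size (rcons s x))%:Z)%R.
Proof.
rewrite /aact size_rcons /=; congr (_, _); last by lia.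
apply: functional_extensionality => z; rewrite /segment.
have [->|ne] := eqVneq z _; first by rewrite addrC addKr nth_rcons ltnn eqxx.
case e: (z - b)%R => [i|] //.
rewrite nth_rcons; case: ltngtP => // [lt|eqi]; first by rewrite nth_default // ltnW.
by move/eqP: ne; case; rewrite -eqi -e; lia.
Qed.

Definition input_bit (s : sym) : option bool := if s is Some (inl b) then Some b else None.

(** The input is erased while it is copied: the output is written further right on the same tape,
    and the blank cell before it lets the final [rewind] find its first bit. *)
Definition read_input (start : bool) : prog := Act (fun v x =>
  match x with
  | None => (None, Some true)
  | Some (inl (inr _)) => (cellsym (false, start, input_bit (v None)), Some true)
  | _ => (v x, None)
  end).

Definition all_loops : mover := fun x => if x is Some (inl (inr _)) then Some true else None.

Definition setup_loops : prog :=
  Seq (read_input true)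
  (Seq (While (nonblank None) (read_input false))
  (Seq (read_input false)
  (Seq (read_input false) (rewind all_loops (loopT ord0))))).

Definition reading vars diffs ctr (L : seq cell) (w : word) : atapes :=
  mk (fun _ => (segment 0%R (cells L), (size L)%:Z%R)) vars diffs ctr
     (segment (size L)%:Z%R (bits w), (size L)%:Z%R).

Lemma runs_read_input start vars diffs ctr L w :
  runs (read_input start) (reading vars diffs ctr L w) 1
       (reading vars diffs ctr (rcons L (false, start, ohead w)) (behead w)).
Proof.
set T := reading _ _ _ _ _; set T' := reading _ _ _ _ _.
have {1}-> : T' = apply_acts (fun x => match x with
    | None => (None, Some true)
    | Some (inl (inr _)) => (cellsym (false, start, input_bit (see T None)), Some true)
    | _ => (see T x, None)
    end) T; last exact: runs_act.
apply: eq_atapes => [i|||||] *; rewrite /apply_acts ?aact_keep //=.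
  rewrite -(add0r (size L)%:Z%R) -size_cells segment_rcons add0r.
  rewrite -map_rcons size_cells (_ : input_bit _ = ohead w) //.
  by rewrite /see /ascan /= /segment subrr; case: (w).
rewrite /aact size_rcons /=; congr (_, _); last by lia.
apply: functional_extensionality => z; rewrite /segment.
move: (size L) => n.
have [->|ne] := eqVneq z n.
  by rewrite (_ : (_ - _)%R = (-1)%R) //; lia.
case E: (z - Posz n)%R => [i|i].
  have [i' ei] : exists i', i = i'.+1 by exists i.-1; move/eqP: ne; lia.
  by rewrite (_ : (z - _)%R = Posz i'); [rewrite ei; case: (w) => //=; rewrite nth_nil|lia].
case E': (z - _)%R => [i'|i'] //; lia.
Qed.

Lemma runs_read_inputs vars diffs ctr L w :
  runs (While (nonblank None) (read_input false)) (reading vars diffs ctr L w)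
       (2 * size w + 1)
       (reading vars diffs ctr (L ++ [seq (false, false, Some b) | b <- w]) [::]).
Proof.
elim: w L => [|b w IH] L /=.
  by rewrite cats0; apply: runs_done; rewrite negbK /see /ascan /= segment_nil.
rewrite -cat_rcons; apply: (@runs_le _ _ _ _ (1 + (2 * size w + 1)).+1); first by lia.
apply: runs_loop; [|exact: runs_read_input|exact: IH].
by rewrite /nonblank /see /ascan /= /segment subrr.
Qed.

Lemma cell_neq_blank (s : seq cell) (i : nat) : i < size s ->
  segment 0%R (cells s) (Posz i) != None.
Proof. by move=> lt; rewrite /segment subr0 (nth_map empty_cell). Qed.

Lemma cell_end (s : seq cell) : segment 0%R (cells s) (Posz (size s)) = None.
Proof. by rewrite /segment subr0 nth_default // size_cells. Qed.

Lemma runs_setup_loops vars diffs ctr w :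
  let l := size (input_cells w) in
  runs setup_loops (mk (fun _ => blank) vars diffs ctr (segment 0%R (bits w), 0%R))
    (4 * l + 8)
    (mk (fun _ => (segment 0%R (cells (input_cells w)), 0%R)) vars diffs ctr
        (segment l%:Z%R [::], l%:Z%R)).
Proof.
set l := size _ => /=.
have lE : l = (size w).-1.+3.
  by rewrite /l /= size_cat size_map size_behead /= addn2.
rewrite (_ : mk _ _ _ _ (_, 0%R) = reading vars diffs ctr [::] w) //.
apply: (@runs_le _ _ _ _
  (1 + ((2 * (size w).-1 + 1) + (1 + (1 + (2 * l + 3)))))); first by lia.
apply: runs_seq (runs_read_input _ _ _ _ _ _) _.
rewrite -size_behead; apply: runs_seq (runs_read_inputs _ _ _ _ _) _.
apply: runs_seq (runs_read_input _ _ _ _ _ _) _.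
apply: runs_seq (runs_read_input _ _ _ _ _ _) _.
rewrite -!cats1 -!catA /= -/(input_cells w) /reading -/l.
set T := mk _ _ _ _ _; set T' := mk _ _ _ _ _.
have -> : T' = shift all_loops (- l%:Z)%R T.
  apply: eq_atapes => *; rewrite /shift /= ?mul0r ?addr0 -?surjective_pairing //.
  by congr (_, _); rewrite mul1r subrr.
apply: (@runs_rewind _ _ _ _ _ 0%R) => //.
by move=> i lt; rewrite add0r; apply: cell_neq_blank.
Qed.

Definition write_vars (f : view -> sym) : prog := Act (fun v x =>
  if x is Some (inl (inl (inl (inl _)))) then (f v, Some true) else (v x, None)).

Definition one_loop (i : 'I_d.+1) : mover := fun x =>
  if x is Some (inl (inr i')) then if i' == i then Some true else None else None.

Definition all_vars : mover := fun x =>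
  if x is Some (inl (inl (inl (inl _)))) then Some true else None.

(** With one loop per tape over [l] cells, [k] nested loops run the body [l ^ k] times, which yields
    a power of the length without arithmetic. *)
Fixpoint nest (js : seq 'I_d.+1) (body : prog) : prog :=
  if js is i :: js' then For (one_loop i) (loopT i) (nest js' body) else body.

Fixpoint nest_cost (l k : nat) : nat :=
  if k is k'.+1 then l * (nest_cost l k' + 4) + 4 else 1.

Definition write_margin : prog :=
  nest (enum 'I_d.+1) (write_vars (fun _ => cellsym empty_cell)).

Definition setup_vars : prog :=
  Seq (write_vars (fun _ => cellsym (true, false, None)))
  (Seq write_margin
  (Seq (For (one_loop ord0) (loopT ord0) (write_vars (fun v => v (loopT ord0))))
  (Seq write_margin (rewind all_vars (varT (false, false)))))).

Section Drawing.

Variables (L : seq cell) (diffs : bool -> atape) (ctr out : atape).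

Definition drawing (lp : 'I_d.+1 -> int) (U : seq cell) : atapes :=
  mk (fun i => (segment 0%R (cells L), lp i))
     (fun _ => (segment 0%R (cells U), (size U)%:Z%R)) diffs ctr out.

Lemma runs_write_vars f lp U c : f (see (drawing lp U)) = cellsym c ->
  runs (write_vars f) (drawing lp U) 1 (drawing lp (rcons U c)).
Proof.
move=> fE; have -> : drawing lp (rcons U c) = apply_acts (fun x =>
  if x is Some (inl (inl (inl (inl _)))) then (f (see (drawing lp U)), Some true)
  else (see (drawing lp U) x, None)) (drawing lp U); last exact: runs_act.
apply: eq_atapes => *; rewrite /apply_acts ?aact_keep //=.
rewrite fE -(add0r (size U)%:Z%R) -size_cells segment_rcons add0r.
by rewrite -map_rcons size_cells.
Qed.

Lemma shift_drawing i n lp U :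
  shift (one_loop i) n (drawing lp U) =
  drawing (fun k => lp k + (if k == i then n else 0))%R U.
Proof.
apply: eq_atapes => *; rewrite /shift /= ?mul0r ?addr0 -?surjective_pairing //.
by case: eqP => _; rewrite /= ?mul1r ?mul0r.
Qed.

Lemma runs_for_drawing i body lp (U : nat -> seq cell) c : lp i = 0%R ->
  (forall n, n < size L -> runs body (shift (one_loop i) (Posz n) (drawing lp (U n))) c
                           (shift (one_loop i) (Posz n) (drawing lp (U n.+1)))) ->
  runs (For (one_loop i) (loopT i) body) (drawing lp (U 0))
       (size L * (c + 4) + 4) (drawing lp (U (size L))).
Proof.
move=> lpi; apply: (runs_for (f := segment 0%R (cells L)) (A := fun n => drawing lp (U n))).
- by rewrite /= eqxx.
- exact: cell_neq_blank.
- exact: cell_end.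
- exact: segment_lt.
- by move=> n _; rewrite /drawing /= lpi.
Qed.

Lemma runs_nest js lp U : uniq js -> {in js, forall i, lp i = 0%R} ->
  runs (nest js (write_vars (fun _ => cellsym empty_cell))) (drawing lp U)
       (nest_cost (size L) (size js))
       (drawing lp (U ++ nseq (size L ^ size js) empty_cell)).
Proof.
elim: js lp U => [|i js IH] lp U /=.
  by move=> _ _; rewrite cats1; apply: runs_write_vars.
move=> /andP[ni ujs] lp0; rewrite expnS -[X in drawing lp X]cats0.
pose V n := U ++ nseq (n * size L ^ size js) empty_cell.
apply: (runs_for_drawing (U := V)); first by rewrite lp0 // mem_head.
move=> n _; rewrite !shift_drawing /V mulSn addnC nseqD catA; apply: IH => // k ki.
rewrite lp0 ?in_cons ?ki ?orbT // ifN //.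
by apply: contraNneq ni => <-.
Qed.

Lemma runs_copy U :
  runs (For (one_loop ord0) (loopT ord0) (write_vars (fun v => v (loopT ord0))))
    (drawing (fun _ => 0%R) U) (size L * 5 + 4) (drawing (fun _ => 0%R) (U ++ L)).
Proof.
pose V n := U ++ take n L.
have -> : U ++ L = V (size L) by rewrite /V take_size.
have {1}-> : U = V 0 by rewrite /V take0 cats0.
apply: (runs_for_drawing (c := 1)) => // n ltn.
rewrite !shift_drawing /V (take_nth empty_cell) // -rcons_cat.
apply: runs_write_vars; rewrite /see /ascan /= add0r /segment subr0.
by rewrite (nth_map empty_cell).
Qed.

End Drawing.

Lemma runs_setup_vars w diffs ctr out :
  let l := size (input_cells w) in
  runs setup_vars
    (mk (fun _ => (segment 0%R (cells (input_cells w)), 0%R)) (fun _ => blank) diffs ctr out)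
    (2 * nest_cost l d.+1 + l * 5 + 2 * size (line d w) + 8)
    (mk (fun _ => (segment 0%R (cells (input_cells w)), 0%R))
        (fun _ => (segment 0%R (cells (line d w)), 0%R)) diffs ctr out).
Proof.
move=> l.
apply: (@runs_le _ _ _ _ (1 + (nest_cost l d.+1 + ((l * 5 + 4) + (nest_cost l d.+1 +
  (2 * size (line d w) + 3)))))).
  by move: (nest_cost l d.+1) (size (line d w)) => a b; clearbody l; lia.
pose D := drawing (input_cells w) diffs ctr out (fun _ => 0%R).
have margin U : runs write_margin (D U) (nest_cost l d.+1) (D (U ++ nseq (l ^ d.+1) empty_cell)).
  by rewrite -[in nest_cost _ _](size_enum_ord d.+1) -[in _ ^ _](size_enum_ord d.+1);
     apply: runs_nest; rewrite ?enum_uniq.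
rewrite (_ : mk _ (fun _ => blank) _ _ _ = D [::]) //.
apply: (runs_seq (T2 := D [:: (true, false, None)])); first exact: runs_write_vars.
apply: runs_seq (margin _) _.
apply: runs_seq (runs_copy _ _ _ _ _) _.
apply: runs_seq (margin _) _.
rewrite -!catA /= -/l -/(line d w).
set T := D _; set T' := mk _ _ _ _ _.
have -> : T' = shift all_vars (- (size (line d w))%:Z)%R T.
  apply: eq_atapes => *; rewrite /shift /= ?mul0r ?addr0 -?surjective_pairing //.
  by congr (_, _); rewrite mul1r subrr.
apply: (@runs_rewind _ _ _ _ _ 0%R) => //.
by move=> i lt; rewrite add0r; apply: cell_neq_blank.
Qed.

End Setup.

(** * Polynomial bounds and binary numerals *)

(** The base is at least 2 even for [n = 0], so that constants and sums are absorbed by a larger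
    exponent. *)
Definition poly_bounded (f : nat -> nat) : Prop := exists e, forall n, f n <= (n + 2) ^ e.

Lemma poly_bounded_le f g : (forall n, f n <= g n) -> poly_bounded g -> poly_bounded f.
Proof. by move=> le_fg [e le_g]; exists e => n; apply: leq_trans (le_g n). Qed.

Lemma poly_bounded_const c : poly_bounded (fun _ => c).
Proof.
exists c => n; apply: leq_trans (ltnW (ltn_expl c (ltnSn 1))) _.
by case: c => // c; rewrite leq_exp2r // leq_addl.
Qed.

Lemma poly_bounded_id : poly_bounded id.
Proof. by exists 1 => n; rewrite expn1 leq_addr. Qed.

Lemma poly_bounded_add f g :
  poly_bounded f -> poly_bounded g -> poly_bounded (fun n => f n + g n).
Proof.
move=> [a le_f] [b le_g]; exists (a + b).+1 => n; rewrite expnS.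
apply: (@leq_trans (2 * (n + 2) ^ (a + b))); last by rewrite leq_mul2r leq_addl orbT.
rewrite mul2n -addnn leq_add //.
  by apply: leq_trans (le_f n) _; rewrite leq_exp2l ?leq_addr // addn2.
by apply: leq_trans (le_g n) _; rewrite leq_exp2l ?leq_addl // addn2.
Qed.

Lemma poly_bounded_mul f g :
  poly_bounded f -> poly_bounded g -> poly_bounded (fun n => f n * g n).
Proof.
by move=> [a le_f] [b le_g]; exists (a + b) => n; rewrite expnD leq_mul.
Qed.

Lemma poly_bounded_exp f k : poly_bounded f -> poly_bounded (fun n => f n ^ k).
Proof.
move=> bf; elim: k => [|k IH]; first exact: poly_bounded_const 1.
by apply: poly_bounded_le (poly_bounded_mul bf IH) => n; rewrite expnS.
Qed.

Lemma poly_bounded_nest f k : poly_bounded f -> poly_bounded (fun n => nest_cost (f n) k).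
Proof.
move=> bf; elim: k => [|k IH] /=; first exact: poly_bounded_const 1.
apply: poly_bounded_add (poly_bounded_const 4).
by apply: poly_bounded_mul bf (poly_bounded_add IH (poly_bounded_const 4)).
Qed.

Definition input_length (n : nat) : nat := n.-1.+3.

Lemma size_input_cells w : size (input_cells w) = input_length (size w).
Proof. by rewrite /= size_cat size_map size_behead /= addn2. Qed.

Definition line_length (d n : nat) : nat :=
  (input_length n ^ d.+1 + (input_length n + input_length n ^ d.+1)).+1.

Lemma size_line d w : size (line d w) = line_length d (size w).
Proof.
rewrite /line /line_length -size_input_cells; move: (input_cells w) => L.
by rewrite /= !size_cat !size_nseq.
Qed.

Lemma poly_bounded_input_length : poly_bounded input_length.
Proof.
apply: poly_bounded_le (poly_bounded_add poly_bounded_id (poly_bounded_const 3)) => n.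
by rewrite /input_length; lia.
Qed.

Lemma poly_bounded_line_length d : poly_bounded (line_length d).
Proof.
have b := poly_bounded_exp d.+1 poly_bounded_input_length.
apply: poly_bounded_le (poly_bounded_add (poly_bounded_const 1) (poly_bounded_add b
  (poly_bounded_add poly_bounded_input_length b))) => n.
by rewrite /line_length add1n.
Qed.

Definition natbits (n : nat) : word := mkseq (fun i => odd (n %/ 2 ^ i)) (up_log 2 n.+1).

Fixpoint increment (c : word) : word :=
  match c with
  | true :: c' => false :: increment c'
  | false :: c' => true :: c'
  | [::] => [:: true]
  end.

Lemma natbits_half n : 0 < n -> natbits n = odd n :: natbits n./2.
Proof.
move=> n0; rewrite /natbits.
have -> : up_log 2 n.+1 = (up_log 2 (n./2).+1).+1.
  have le := up_logP (n./2).+1 (ltnSn 1).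
  apply/eqP; rewrite eqn_leq; apply/andP; split.
    by apply: up_log_min => //; rewrite expnS mul2n; lia.
  have := up_logP n.+1 (ltnSn 1); case: (up_log 2 n.+1) => [|k]; first by lia.
  rewrite expnS mul2n ltnS => le2; apply: up_log_min => //; lia.
rewrite /mkseq /= divn1 -[1]addn0 iotaDl -map_comp; congr (_ :: _).
by apply: eq_map => i /=; rewrite expnD divnMA divn2.
Qed.

Lemma natbitsS n : natbits n.+1 = increment (natbits n).
Proof.
elim/ltn_ind: n => -[|n] IH //.
rewrite natbits_half // [in RHS]natbits_half //= negbK uphalf_half.
case: (boolP (odd n)) => on /=; first by rewrite add1n.
by rewrite add0n IH //; lia.
Qed.

Lemma size_natbits n : size (natbits n) <= n.
Proof.
by rewrite size_mkseq; apply: up_log_min => //; apply: ltn_expl.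
Qed.

(** Splits a numeral where the carry stops, which is where the head of the counter stops in [tick];
    [r] is empty when the carry adds a digit. *)
Lemma increment_split c : exists k r, c = nseq k true ++ r /\
  [/\ head false r = false, increment c = nseq k false ++ true :: behead r & k <= size c].
Proof.
elim: c => [|[] c [k [r [-> [hr iE le]]]]]; first by exists 0, [::].
  by exists k.+1, r; rewrite /= iE; split=> //; split=> //; rewrite ltnS.
by exists 0, (false :: nseq k true ++ r).
Qed.

(** * Programs that output a word and count *)

Section Generation.

Variables (d : nat) (Y GY : finType).

Notation gsym := (gsym GY).
Notation tname := (tname d Y).
Notation view := (view gsym tname).
Notation atapes := (atapes gsym tname).
Notation prog := (prog gsym tname).
Notation runs := (@runs gsym tname).
Notation mover := (mover tname).
Notation bitsym := (bitsym GY).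
Notation ctrT := (ctrT d Y).
Notation bits_of := (bits GY).

Definition env := bool * bool -> nat.

Definition update (e : env) v i : env := fun u => if u == v then i else e u.

(* The counter holds the bits [c] and is scanned at [cp]; the bits [o] have been
   written, after the cells freed by the input. *)
Definition main_tapes (w : word) (e : env) (c : word) (cp : int) (o : word) : atapes :=
  let base := (size (input_cells w))%:Z%R in
  mk (fun _ => (segment 0%R (cells GY (input_cells w)), 0%R))
     (fun v => (segment 0%R (cells GY (line d w)), (e v)%:Z%R))
     (fun tp => (@diffmark GY, (e (true, tp))%:Z - (e (false, tp))%:Z)%R)
     (segment 0%R (bits_of c), cp)
     (segment base (bits_of o), (base + (size o)%:Z)%R).

Definition emit_from (f : view -> symbol gsym) : prog :=
  Act (fun v x => if x is None then (f v, Some true) else (v x, None)).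

Lemma runs_emit_from f w e c cp o b : f (see (main_tapes w e c cp o)) = bitsym b ->
  runs (emit_from f) (main_tapes w e c cp o) 1 (main_tapes w e c cp (rcons o b)).
Proof.
set T := main_tapes _ _ _ _ _ => fE.
have -> : main_tapes w e c cp (rcons o b) = apply_acts (fun x =>
    if x is None then (f (see T), Some true) else (see T x, None)) T; last exact: runs_act.
apply: eq_atapes => *; rewrite /apply_acts ?aact_keep // fE.
by rewrite [T None]/= -(size_bits GY) segment_rcons -map_rcons size_bits.
Qed.

Definition emit (b : bool) : prog := emit_from (fun _ => bitsym b).

Variable limit : nat -> nat.
Hypothesis poly_limit : poly_bounded limit.

(* With the variables in [vs] at [0], the program [p] writes [D w e] and
   increments the counter [t w e] times, in polynomial time. *)
Definition generates (vs : seq (bool * bool)) (p : prog)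
    (D : word -> env -> word) (t : word -> env -> nat) : Prop :=
  exists2 f, poly_bounded f & forall w e n o,
    {in vs, forall v, e v = 0} -> n + t w e <= limit (size w) ->
    runs p (main_tapes w e (natbits n) 0%R o) (f (size w))
           (main_tapes w e (natbits (n + t w e)) 0%R (o ++ D w e)).

Lemma generates_ext vs p D t D' t' : (forall w e, D w e = D' w e) ->
  (forall w e, t w e = t' w e) -> generates vs p D t -> generates vs p D' t'.
Proof.
move=> eD et [f bf runp]; exists f => // w e n o.
by rewrite -eD -et; apply: runp.
Qed.

Lemma generates_sub vs vs' p D t : {subset vs <= vs'} ->
  generates vs p D t -> generates vs' p D t.
Proof.
move=> sub [f bf runp]; exists f => // w e n o e0; apply: runp => v /sub; exact: e0.
Qed.

Lemma generates_skip vs :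
  generates vs (seqs [::]) (fun _ _ => [::]) (fun _ _ => 0).
Proof.
exists (fun _ => 1); first exact: poly_bounded_const.
by move=> w e n o _ _; rewrite addn0 cats0; apply: runs_skip.
Qed.

Lemma generates_seq vs p1 p2 D1 D2 t1 t2 :
  generates vs p1 D1 t1 -> generates vs p2 D2 t2 ->
  generates vs (Seq p1 p2) (fun w e => D1 w e ++ D2 w e) (fun w e => t1 w e + t2 w e).
Proof.
move=> [f1 bf1 run1] [f2 bf2 run2]; exists (fun n => f1 n + f2 n).
  exact: poly_bounded_add.
move=> w e n o e0 le; rewrite addnA catA; apply: runs_seq.
  by apply: run1 => //; lia.
by apply: run2 => //; lia.
Qed.

Lemma generates_seqs (I : Type) (r : seq I) vs (p : I -> prog) D t :
  (forall i, generates vs (p i) (D i) (t i)) ->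
  generates vs (seqs [seq p i | i <- r])
    (fun w e => flatten [seq D i w e | i <- r])
    (fun w e => sumn [seq t i w e | i <- r]).
Proof.
move=> genp; elim: r => [|i r IH]; first exact: generates_skip.
exact: generates_seq (genp i) IH.
Qed.

Lemma generates_emit vs b : generates vs (emit b) (fun _ _ => [:: b]) (fun _ _ => 0).
Proof.
exists (fun _ => 1); first exact: poly_bounded_const.
by move=> w e n o _ _; rewrite addn0 cats1; apply: runs_emit_from.
Qed.

Definition emits (u : word) : prog := seqs [seq emit b | b <- u].

Lemma generates_emits vs u : generates vs (emits u) (fun _ _ => u) (fun _ _ => 0).
Proof.
have := generates_seqs u (generates_emit vs); apply: generates_ext => w e.
  by elim: u => //= b u ->.
by elim: u.
Qed.

Lemma generates_if vs b b' p1 p2 D1 D2 t1 t2 :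
  (forall w e n o, b (see (main_tapes w e (natbits n) 0%R o)) = b' w e) ->
  generates vs p1 D1 t1 -> generates vs p2 D2 t2 ->
  generates vs (If b p1 p2) (fun w e => if b' w e then D1 w e else D2 w e)
    (fun w e => if b' w e then t1 w e else t2 w e).
Proof.
move=> bE [f1 bf1 run1] [f2 bf2 run2]; exists (fun n => 1 + (f1 n + f2 n)).
  exact: poly_bounded_add (poly_bounded_const 1) (poly_bounded_add bf1 bf2).
move=> w e n o e0 le; apply: runs_if; rewrite bE; case: (b' w e) le => le.
  by apply: runs_le (run1 _ _ _ _ e0 le); apply: leq_addr.
by apply: runs_le (run2 _ _ _ _ e0 le); apply: leq_addl.
Qed.

(** The move [Some v.1] takes the head of the difference tape to the right with a variable of the
    rounds and to the left with one of the experts, which keeps it at their difference. *)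
Definition var_mover (v : bool * bool) : mover := fun x =>
  match x with
  | Some (inl (inl (inl (inl u)))) => if u == v then Some true else None
  | Some (inl (inl (inl (inr tp)))) => if tp == v.2 then Some v.1 else None
  | _ => None
  end.

Lemma shift_main v (i : nat) w e c cp o : e v = 0 ->
  shift (var_mover v) i%:Z%R (main_tapes w e c cp o) = main_tapes w (update e v i) c cp o.
Proof.
move=> ev; apply: eq_atapes => *; rewrite /shift /= ?mul0r ?addr0 //; congr (_, _).
  rewrite /update; case: eqP => [->|_]; last by rewrite mul0r addr0.
  by rewrite ev mul1r add0r.
rewrite /update; case: v ev => r tp ev; rewrite !xpair_eqE /=.
case: eqP => [->|_]; last by rewrite !andbF mul0r addr0.
by case: r ev => /= ev; rewrite ?ev; lia.
Qed.

Definition for_var (v : bool * bool) (p : prog) : prog := For (var_mover v) (varT d Y v) p.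

Lemma generates_for v vs p D t : v \notin vs -> generates vs p D t ->
  generates (v :: vs) (for_var v p)
    (fun w e => flatten [seq D w (update e v i) | i <- iota 0 (size (line d w))])
    (fun w e => sumn [seq t w (update e v i) | i <- iota 0 (size (line d w))]).
Proof.
move=> nv [f bf runp]; exists (fun n => line_length d n * (f n + 4) + 4).
  apply: poly_bounded_add (poly_bounded_const 4).
  apply: poly_bounded_mul (poly_bounded_line_length d) _.
  exact: poly_bounded_add bf (poly_bounded_const 4).
move=> w e n o e0 le.
pose tk k := sumn [seq t w (update e v i) | i <- iota 0 k].
pose A k := main_tapes w e (natbits (n + tk k)) 0%R
              (o ++ flatten [seq D w (update e v i) | i <- iota 0 k]).
rewrite -[X in runs _ X](_ : A 0 = _); last by rewrite /A /tk /= addn0 cats0.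
rewrite -/(tk _) -/(A _) -size_line.
have ev : e v = 0 by rewrite e0 ?mem_head.
have tkS k : tk k.+1 = tk k + t w (update e v k).
  by rewrite /tk -addn1 iotaD map_cat sumn_cat /= addn0.
have tk_mono k l : k <= l -> tk k <= tk l.
  elim: l => [|l IH]; first by rewrite leqn0 => /eqP->.
  rewrite leq_eqVlt => /predU1P[->//|/IH] /leq_trans-> //.
  by rewrite tkS leq_addr.
apply: (runs_for (f := segment 0%R (cells GY (line d w)))).
- by rewrite /= eqxx.
- exact: cell_neq_blank.
- exact: cell_end.
- exact: segment_lt.
- by move=> k _; rewrite /A /= ev.
move=> k ltk; rewrite !shift_main // tkS addnA -addn1 iotaD map_cat flatten_cat catA /= cats0.
apply: runp => [u uvs|].
  by rewrite /update ifN ?e0 ?in_cons ?uvs ?orbT //; apply: contraNneq nv => <-.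
by rewrite -addnA -tkS; apply: leq_trans le; rewrite leq_add2l; exact: (tk_mono _ _ ltk).
Qed.

Definition ctr_mover : mover := fun x => if x is Some (inl (inl (inr _))) then Some true else None.

Definition write_ctr (b : bool) (m : move) : prog := Act (fun v x =>
  if x is Some (inl (inl (inr _))) then (bitsym b, m) else (v x, None)).

Lemma runs_write_ctr b m w e c cp o pre post : c = pre ++ post -> cp = (size pre)%:Z%R ->
  runs (write_ctr b m) (main_tapes w e c cp o) 1
       (main_tapes w e (pre ++ b :: behead post) (cp + offset m)%R o).
Proof.
set T := main_tapes _ _ _ _ _ => cE cpE; set T' := main_tapes _ _ _ _ _.
have -> : T' = apply_acts (fun x =>
    if x is Some (inl (inl (inr _))) then (bitsym b, m) else (see T x, None)) T.
  apply: eq_atapes => *; rewrite /apply_acts ?aact_keep //= /aact /=; congr (_, _).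
  apply: functional_extensionality => z; rewrite cpE cE.
  rewrite /segment subr0 /bits !map_cat.
  case: z => [z|z] //; rewrite !nth_cat size_map.
  rewrite eqz_nat; have [->|ne] := eqVneq z (size pre); first by rewrite ltnn subnn.
  case: ifP => // /negbT; rewrite -leqNgt leq_eqVlt => /orP[/eqP eq|lt].
    by rewrite eq eqxx in ne.
  have [k ->] : exists k, z - size pre = k.+1 by exists (z - size pre).-1; lia.
  by case: (post) => //=; rewrite nth_nil.
exact: runs_act.
Qed.

Definition scans_true (v : view) : bool := v ctrT == bitsym true.

Definition tick : prog :=
  Seq (While scans_true (write_ctr false (Some true)))
      (Seq (write_ctr true None) (rewind ctr_mover ctrT)).

Lemma bit_neq_blank (s : word) (i : nat) : i < size s ->
  segment 0%R (bits_of s) (Posz i) != None.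
Proof. by move=> lt; rewrite /segment subr0 (nth_map false). Qed.

Lemma shift_ctr w e c cp o n :
  shift ctr_mover n (main_tapes w e c cp o) = main_tapes w e c (cp + n)%R o.
Proof. by apply: eq_atapes => *; rewrite /shift /= ?mul0r ?addr0 ?mul1r. Qed.

Lemma runs_carry w e o pre k r : head false r = false ->
  runs (While scans_true (write_ctr false (Some true)))
    (main_tapes w e (pre ++ nseq k true ++ r) (size pre)%:Z%R o) (2 * k + 1)
    (main_tapes w e (pre ++ nseq k false ++ r) (size pre + k)%:Z%R o).
Proof.
move=> hr; elim: k pre => [|k IH] pre /=.
  rewrite addn0; apply: runs_done; rewrite /scans_true /see /ascan /=.
  rewrite /segment subr0 /bits map_cat nth_cat size_map ltnn subnn.
  by case: r hr => [|[] r].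
apply: (@runs_le _ _ _ _ (1 + (2 * k + 1)).+1); first by lia.
apply: (runs_loop (T2 := main_tapes w e (rcons pre false ++ nseq k true ++ r)
                                     (size (rcons pre false))%:Z%R o)).
- rewrite /scans_true /see /ascan /= /segment subr0 /bits map_cat nth_cat.
  by rewrite size_map ltnn subnn.
- rewrite cat_rcons size_rcons (_ : Posz (size pre).+1 = Posz (size pre) + 1)%R; last by lia.
  exact: (runs_write_ctr _ _ _ _ _ (post := true :: nseq k true ++ r)).
by have := IH (rcons pre false); rewrite !cat_rcons size_rcons addSnnS.
Qed.

Lemma runs_tick w e c o :
  runs tick (main_tapes w e c 0%R o) (4 * size c + 5) (main_tapes w e (increment c) 0%R o).
Proof.
have [k [r [-> [hr -> lek]]]] := increment_split c.
apply: (@runs_le _ _ _ _ ((2 * k + 1) + (1 + (2 * k + 3)))).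
  by rewrite !size_cat !size_nseq; lia.
apply: runs_seq (runs_carry w e o [::] k hr) _.
apply: runs_seq.
  by apply: (@runs_write_ctr true None _ _ _ _ _ (nseq k false)); rewrite ?size_nseq.
rewrite addr0; set T := main_tapes _ _ _ _ _; set T' := main_tapes _ _ _ _ _.
have -> : T' = shift ctr_mover (- k%:Z)%R T by rewrite shift_ctr subrr.
apply: (@runs_rewind _ _ _ _ _ 0%R) => //.
by move=> i lt; rewrite add0r; apply: bit_neq_blank; rewrite size_cat size_nseq /=; lia.
Qed.

Lemma generates_tick vs : generates vs tick (fun _ _ => [::]) (fun _ _ => 1).
Proof.
exists (fun n => 4 * limit n + 5).
  apply: poly_bounded_add (poly_bounded_const 5).
  exact: poly_bounded_mul (poly_bounded_const 4) poly_limit.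
move=> w e n o _ le; rewrite addn1 natbitsS cats0.
apply: runs_le (runs_tick _ _ _ _).
by rewrite leq_add2r leq_mul2l /=; apply: leq_trans (size_natbits n) _; lia.
Qed.

Definition emit_ctr : prog :=
  Seq (For ctr_mover ctrT (Seq (emit true) (emit_from (fun v => v ctrT)))) (emit false).

Lemma runs_emit_ctr w e c o :
  runs emit_ctr (main_tapes w e c 0%R o) (size c * 6 + 5)
       (main_tapes w e c 0%R (o ++ code_word c)).
Proof.
rewrite /code_word catA cats1.
apply: (@runs_le _ _ _ _ ((size c * 6 + 4) + 1)); first by lia.
apply: runs_seq; last exact: runs_emit_from.
pose A k := main_tapes w e c 0%R (o ++ flatten [seq [:: true; b] | b <- take k c]).
rewrite -[X in runs _ X](_ : A 0 = _); last by rewrite /A take0 cats0.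
rewrite -[X in runs _ _ _ X](_ : A (size c) = _); last by rewrite /A take_size.
apply: (runs_for (f := segment 0%R (bits_of c)) (c := 2)) => //.
- by move=> i; apply: bit_neq_blank.
- by rewrite /segment subr0 nth_default // size_map.
move=> i lti; rewrite !shift_ctr add0r (take_nth false) // map_rcons flatten_rcons /= catA.
rewrite -cat1s catA !cats1; apply: (@runs_le _ _ _ _ (1 + 1)) => //.
apply: runs_seq; first exact: runs_emit_from.
apply: runs_emit_from; rewrite /see /ascan /= /segment subr0.
by rewrite (nth_map false).
Qed.

Definition out_mover : mover := fun x => if x is None then Some true else None.

Lemma runs_rewind_out w e c cp o : exists2 T,
  runs (rewind out_mover None) (main_tapes w e c cp o) (2 * size o + 3) T &
  T None = (segment (size (input_cells w))%:Z%R (bits_of o), (size (input_cells w))%:Z%R) /\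
  forall y, T (Some (inr y)) = blank GY.
Proof.
set T := main_tapes _ _ _ _ _; set b := (size (input_cells w))%:Z%R.
exists (shift out_mover (- (size o)%:Z)%R T).
  apply: (@runs_rewind _ _ _ _ _ b) => //=; last by rewrite segment_lt // ltrBlDr ltrDl.
  by move=> i lt; rewrite segment_nth (nth_map false).
split; first by rewrite /shift /= mul1r -addrA subrr addr0.
by move=> y; rewrite /shift /= mul0r addr0.
Qed.

End Generation.

(** * The word of the instance and the program that writes it *)

Section Layout.

Variables (kind : finType) (d : nat).

Definition coords (J : nat) : seq (nat * nat * kind) :=
  [seq (sj, k) | sj <- [seq (s, j) | s <- iota 0 J, j <- iota 0 J], k <- enum kind].

Definition rows (J : nat) : seq (option (nat * nat * kind)) := None :: map Some (coords J).

Definition items (J : nat) : seq (bool * option (nat * nat * kind)) :=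
  [seq (b, y) | b <- [:: false; true], y <- rows J].

Lemma size_coords J : size (coords J) = J * J * #|kind|.
Proof. by rewrite !size_allpairs !size_iota cardE. Qed.

Lemma size_rows J : size (rows J) = (J * J * #|kind|).+1.
Proof. by rewrite /= size_map size_coords. Qed.

Lemma size_items J : size (items J) = 2 * size (rows J).
Proof. by rewrite size_allpairs. Qed.

Variable unit_weight : kind -> cell -> cell -> int.
Variable weight : kind -> kind -> (move -> bool) -> (move -> bool) -> int.

Definition at_offset (s s' : nat) (m : move) : bool := s'%:Z%R == (s%:Z + offset m)%R.

Definition cell_at (w : word) (s : nat) : cell := nth empty_cell (line d w) s.

(* [(false, None)] is the expert whose selection signals the absence of a
   solution, [(true, None)] the one every solution contains, and the
   [(false, Some _)] fill up the team. *)
Definition coef (w : word) (x : bool * option (nat * nat * kind))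
    (y : option (nat * nat * kind)) : int :=
  match x, y with
  | (false, None), None => 1%R
  | (true, None), Some (s', j', r) => unit_weight r (cell_at w s') (cell_at w j')
  | (true, Some (s, j, k)), Some (s', j', r) =>
      weight k r (at_offset s s') (at_offset j j')
  | _, _ => 0%R
  end.

Definition code_int (z : int) : word := code_rat (z%:~R)%R.

Definition instance_word (w : word) : word :=
  let J := size (line d w) in let m := size (rows J) in
  code_nat (2 * m) ++ code_nat m ++ code_nat m ++
  flatten [seq code_int (coef w x y) | x <- items J, y <- rows J] ++
  flatten [seq code_int 0 | y <- rows J].

Lemma flatten_coords (F : nat -> nat -> kind -> word) J :
  flatten [seq flatten [seq flatten [seq F s j k | k <- enum kind] | j <- iota 0 J]
          | s <- iota 0 J] =
  flatten [seq F x.1.1 x.1.2 x.2 | x <- coords J].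
Proof.
(* The induction runs on the outer list only; the inner list stays whole. *)
rewrite /coords; move: (iota 0 J) => r2. elim: {2 4}r2 => [|s r IH] //=.
rewrite {}IH allpairs_cat map_cat flatten_cat; congr (_ ++ _).
elim: r2 => [|j r2 IH] //=; rewrite {}IH map_cat flatten_cat; congr (_ ++ _).
by rewrite -map_comp.
Qed.

Lemma sumn_coords J c :
  sumn [seq sumn [seq sumn [seq c | _ <- enum kind] | _ <- iota 0 J] | _ <- iota 0 J] =
  J * J * #|kind| * c.
Proof.
have sumn_const (T : Type) (r : seq T) a : sumn [seq a | _ <- r] = size r * a.
  by elim: r => //= _ r ->.
by rewrite !sumn_const !size_iota -cardE !mulnA.
Qed.

Variables (Y GY : finType) (suffix : word).
Notation gsym := (gsym GY).
Notation tname := (tname d Y).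
Notation view := (view gsym tname).
Notation prog := (prog gsym tname).
Notation main_tapes := (@main_tapes d Y GY).

(** With finitely many values, the machine chooses between constant words by tests and never
    computes the code of a number. *)
Definition weights : seq int := [:: 0; 2; -2]%R.
Hypothesis unit_weight_in : forall r c c', unit_weight r c c' \in weights.
Hypothesis weight_in : forall k r f g, weight k r f g \in weights.

Definition limit (n : nat) : nat := (line_length d n * line_length d n * #|kind|).+1.

Lemma poly_limit : poly_bounded limit.
Proof.
apply: (@poly_bounded_le _ (fun n => line_length d n * line_length d n * #|kind| + 1)).
  by move=> n; rewrite addn1.
have b := poly_bounded_line_length d.
exact: poly_bounded_add (poly_bounded_mul (poly_bounded_mul b b) (poly_bounded_const _))
  (poly_bounded_const 1).
Qed.

Notation generates := (@generates d Y GY limit).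
Notation emits := (@emits d Y GY).
Notation for_var := (@for_var d Y GY).
Notation tick := (@tick d Y GY).

Definition emit_weight (f : view -> int) : prog :=
  If (fun v => f v == 0%R) (emits (code_int 0))
    (If (fun v => f v == 2%R) (emits (code_int 2)) (emits (code_int (-2)))).

Lemma generates_emit_weight vs f g :
  (forall w e n o, f (see (main_tapes w e (natbits n) 0%R o)) = g w e) ->
  (forall w e, g w e \in weights) ->
  generates vs (emit_weight f) (fun w e => code_int (g w e)) (fun _ _ => 0).
Proof.
move=> fE g_in.
apply: generates_ext; last first.
- apply: (generates_if (b' := fun w e => g w e == 0%R)).
  + by move=> w e n o; rewrite fE.
  + exact: generates_emits.
  + apply: (generates_if (b' := fun w e => g w e == 2%R)).
    * by move=> w e n o; rewrite fE.
    * exact: generates_emits.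
    * exact: generates_emits.
- by move=> w e /=; rewrite !if_same.
- move=> w e; move: (g_in w e); rewrite !inE.
  by case: eqP => [->//|_]; case: eqP => [->//|_] /= /eqP->.
Qed.

Definition row_vars := [:: (true, false); (true, true)].
Definition item_vars := [:: (false, false); (false, true)].

Definition row_loop (z : int) (f : kind -> view -> int) : prog :=
  Seq (emits (code_int z))
    (for_var (true, false) (for_var (true, true)
      (seqs [seq emit_weight (f r) | r <- enum kind]))).

Definition row_codes w (z : int) (g : nat -> nat -> kind -> int) : word :=
  code_int z ++ flatten [seq code_int (g x.1.1 x.1.2 x.2) | x <- coords (size (line d w))].

Lemma generates_row_loop z f g :
  (forall r w e n o, f r (see (main_tapes w e (natbits n) 0%R o)) =
     g w (e (false, false)) (e (false, true)) (e (true, false)) (e (true, true)) r) ->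
  (forall w s j s' j' r, g w s j s' j' r \in weights) ->
  generates row_vars (row_loop z f)
    (fun w e => row_codes w z (g w (e (false, false)) (e (false, true)))) (fun _ _ => 0).
Proof.
move=> fE g_in; apply: generates_ext; last first.
- apply: generates_seq; first exact: generates_emits.
  apply: generates_for => //; apply: generates_for => //.
  apply: generates_seqs => r; apply: (@generates_emit_weight _ _ (fun w e =>
    g w (e (false, false)) (e (false, true)) (e (true, false)) (e (true, true)) r)) => //.
- by move=> w e; cbv beta; rewrite (sumn_coords _ 0) muln0.
- by move=> w e; cbv beta; rewrite /row_codes -(flatten_coords (fun s' j' r =>
    code_int (g w (e (false, false)) (e (false, true)) s' j' r))).
Qed.

Definition sees (v : view) (x : option tname) : cell :=
  if v x is Some (inr (inl (inl c))) then c else empty_cell.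

Definition sees_offset (v : view) (tp : bool) (m : move) : bool := v (diffT d Y tp) == marksym GY m.

Definition zero_weight (_ : kind) (_ : view) : int := 0%R.
Definition unit_weight_of (r : kind) (v : view) : int :=
  unit_weight r (sees v (varT d Y (true, false))) (sees v (varT d Y (true, true))).
Definition weight_of (k r : kind) (v : view) : int :=
  weight k r (sees_offset v false) (sees_offset v true).

Lemma sees_main w e n o u :
  sees (see (main_tapes w e (natbits n) 0%R o)) (varT d Y u) = cell_at w (e u).
Proof.
rewrite /sees (_ : see _ _ = segment 0%R (cells GY (line d w)) (e u)) //.
rewrite /segment subr0 /cell_at.
case: (ltnP (e u) (size (line d w))) => [lt|le].
  by rewrite (nth_map empty_cell).
by rewrite !nth_default ?size_cells.
Qed.

Lemma sees_offset_main w e n o tp :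
  sees_offset (see (main_tapes w e (natbits n) 0%R o)) tp =
  at_offset (e (false, tp)) (e (true, tp)).
Proof.
apply: functional_extensionality => m.
rewrite /sees_offset /at_offset /see /ascan /= [in RHS]addrC -subr_eq.
by case: (_ - _)%R m => [[|[|z]]|[|z]] [[]|].
Qed.

Definition for_items (p : kind -> prog) : prog :=
  for_var (false, false) (for_var (false, true) (seqs [seq p k | k <- enum kind])).

Definition count_rows : prog := Seq (for_items (fun _ => tick)) tick.

Lemma generates_count_rows : generates item_vars count_rows
  (fun _ _ => [::]) (fun w _ => size (rows (size (line d w)))).
Proof.
apply: generates_ext; last first.
- apply: generates_seq; last exact: (@generates_tick d Y GY limit poly_limit).
  apply: generates_for => //; apply: generates_for => //.
  by apply: generates_seqs => k; apply: (@generates_tick d Y GY limit poly_limit).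
- by move=> w e; cbv beta; rewrite (sumn_coords _ 1) size_rows muln1 addn1.
- move=> w e; cbv beta; rewrite cats0 (flatten_coords (fun _ _ _ => [::])).
  by elim: (coords _).
Qed.

(** Digits come least significant first, so the numeral of [2 * m] is that of [m] preceded by a zero
    digit, which is coded [[:: true; false]]; the counter then supplies all three sizes. *)
Definition emit_sizes : prog :=
  let c := emit_ctr d Y GY in Seq (emits [:: true; false]) (Seq c (Seq c c)).

Lemma runs_emit_sizes w e n o : 0 < n ->
  runs emit_sizes (main_tapes w e (natbits n) 0%R o) (n * 18 + 18)
    (main_tapes w e (natbits n) 0%R (o ++ code_nat (2 * n) ++ code_nat n ++ code_nat n)).
Proof.
move=> n0; have -> : code_nat (2 * n) = [:: true; false] ++ code_nat n.
  rewrite /code_nat -/(natbits _) -/(natbits n) natbits_half ?muln_gt0 // mul2n.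
  by rewrite odd_double doubleK.
pose c := size (natbits n) * 6 + 5.
apply: (@runs_le _ _ _ _ (3 + (c + (c + c)))).
  by have := size_natbits n; rewrite /c; lia.
have -> : o ++ ([:: true; false] ++ code_nat n) ++ code_nat n ++ code_nat n =
    (((o ++ [:: true; false]) ++ code_nat n) ++ code_nat n) ++ code_nat n.
  by move: (code_nat n) => u; rewrite -!catA.
have emit_n o' : runs (emit_ctr d Y GY) (main_tapes w e (natbits n) 0%R o') c
    (main_tapes w e (natbits n) 0%R (o' ++ code_nat n)) := runs_emit_ctr _ _ _ _ _ _ _.
apply: runs_seq; last by apply: runs_seq (emit_n _) (runs_seq (emit_n _) (emit_n _)).
apply: (@runs_le _ _ _ _ (1 + (1 + 1))) => //.
rewrite -[[:: true; false]]/([:: true] ++ [:: false]) catA.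
rewrite !cats1; do !(apply: runs_seq; first exact: runs_emit_from).
exact: runs_skip.
Qed.

(** The order is that of [items]: the signal expert, the zero experts, the initial expert, the
    events and resources, and then the outcomes. The suffix is the code of the bound in the decision
    version and empty in the search version. *)
Definition write_instance : prog :=
  Seq (row_loop 1 zero_weight)
  (Seq (for_items (fun _ => row_loop 0 zero_weight))
  (Seq (row_loop 0 unit_weight_of)
  (Seq (for_items (fun k => row_loop 0 (weight_of k)))
  (Seq (row_loop 0 zero_weight) (emits suffix))))).

Lemma generates_item_loop f g :
  (forall k r w e n o, f k r (see (main_tapes w e (natbits n) 0%R o)) =
     g k w (e (false, false)) (e (false, true)) (e (true, false)) (e (true, true)) r) ->
  (forall k w s j s' j' r, g k w s j s' j' r \in weights) ->
  generates (item_vars ++ row_vars) (for_items (fun k => row_loop 0 (f k)))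
    (fun w _ => flatten [seq row_codes w 0 (g x.2 w x.1.1 x.1.2) | x <- coords (size (line d w))])
    (fun _ _ => 0).
Proof.
move=> fE g_in; apply: generates_ext; last first.
- apply: generates_for => //; apply: generates_for => //.
  apply: generates_seqs => k; exact: (generates_row_loop 0 (fE k) (g_in k)).
- by move=> w e; cbv beta; rewrite (sumn_coords _ 0) muln0.
- by move=> w e; cbv beta; rewrite -(flatten_coords (fun s j k => row_codes w 0 (g k w s j))).
Qed.

Lemma generates_write_instance : generates (item_vars ++ row_vars) write_instance
  (fun w _ => let J := size (line d w) in
    flatten [seq code_int (coef w x y) | x <- items J, y <- rows J] ++
    flatten [seq code_int 0 | y <- rows J] ++ suffix)
  (fun _ _ => 0).
Proof.
have sub : {subset row_vars <= item_vars ++ row_vars}.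
  by move=> v vr; rewrite mem_cat vr orbT.
have w0 : 0%R \in weights by [].
have zero_loop z := generates_sub sub (@generates_row_loop z zero_weight
  (fun _ _ _ _ _ _ => 0%R) (fun _ _ _ _ _ => erefl) (fun _ _ _ _ _ _ => w0)).
apply: generates_ext; last first.
- apply: generates_seq (zero_loop 1%R) _.
  apply: generates_seq.
    exact: (@generates_item_loop (fun _ => zero_weight) (fun _ _ _ _ _ _ _ => 0%R)).
  apply: generates_seq.
    apply: (generates_sub sub (@generates_row_loop 0%R unit_weight_of
      (fun w _ _ s' j' r => unit_weight r (cell_at w s') (cell_at w j')) _ _)) => //.
    by move=> r w e n o; rewrite /unit_weight_of !sees_main.
  apply: generates_seq.
    apply: (@generates_item_loop weight_of
      (fun k w s j s' j' r => weight k r (at_offset s s') (at_offset j j'))) => //.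
    by move=> k r w e n o; rewrite /weight_of !sees_offset_main.
  apply: generates_seq (zero_loop 0%R) _.
  exact: generates_emits.
- by move=> w e.
move=> w e; cbv beta zeta.
have flat_rows (F : option (nat * nat * kind) -> word) J :
    flatten [seq F y | y <- rows J] = F None ++ flatten [seq F (Some x) | x <- coords J].
  by rewrite /rows map_cons -map_comp.
have flat_pairs (F : _ -> _ -> word) (s : seq (bool * option (nat * nat * kind)))
    (t : seq (option (nat * nat * kind))) :
    flatten [seq F x y | x <- s, y <- t] = flatten [seq flatten [seq F x y | y <- t] | x <- s].
  by elim: s => //= x s IH; rewrite flatten_cat IH.
have flat_bool (F : bool * option (nat * nat * kind) -> word) t :
    flatten [seq F x | x <- [seq (b, y) | b <- [:: false; true], y <- t]] =
    flatten [seq F (false, y) | y <- t] ++ flatten [seq F (true, y) | y <- t].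
  by rewrite /= cats0 map_cat flatten_cat -!map_comp.
rewrite flat_pairs flat_bool /row_codes; move: (size (line d w)) => J.
rewrite !flat_rows.
have -> : [seq code_int (coef w (true, None) (Some x)) | x <- coords J] =
    [seq code_int (unit_weight x.2 (cell_at w x.1.1) (cell_at w x.1.2)) | x <- coords J].
  by apply: eq_map => -[[s' j'] r].
have -> : [seq code_int (coef w (false, None) (Some x)) | x <- coords J] =
    [seq code_int 0 | x <- coords J] by [].
rewrite -!catA; do 5!congr (_ ++ _); congr (flatten _ ++ _).
apply: eq_map => -[[s j] k]; rewrite flat_rows; congr (_ ++ flatten _).
by apply: eq_map => -[[s' j'] r].
Qed.

Definition writing : prog :=
  Seq (setup_diffs d Y GY) (Seq (setup_loops d Y GY) (Seq (setup_vars d Y GY)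
  (Seq count_rows (Seq emit_sizes write_instance)))).

Definition reduction : prog := Seq writing (rewind (@out_mover d Y) None).

Lemma reduction_runs : exists2 f, poly_bounded f & forall w,
  let out := instance_word w ++ suffix in
  size out <= f (size w) /\
  exists2 T, runs reduction (@ainit _ _ w) (f (size w)) T &
    T None = (segment (size (input_cells w))%:Z%R (bits GY out),
              (size (input_cells w))%:Z%R) /\
    forall y, T (Some (inr y)) = blank GY.
Proof.
have [fc bfc runc] := generates_count_rows.
have [fw bfw runw] := generates_write_instance.
pose g n := 4 + (4 * input_length n + 8 +
  (2 * nest_cost (input_length n) d.+1 + input_length n * 5 + 2 * line_length d n + 8 +
  (fc n + (limit n * 18 + 18 + fw n)))).
have bc := poly_bounded_const; have bi := poly_bounded_input_length.
have bg : poly_bounded g.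
  apply: poly_bounded_add (bc 4) _; apply: poly_bounded_add.
    exact: poly_bounded_add (poly_bounded_mul (bc 4) bi) (bc 8).
  apply: poly_bounded_add.
    apply: poly_bounded_add (bc 8); apply: poly_bounded_add; last first.
      exact: poly_bounded_mul (bc 2) (poly_bounded_line_length d).
    apply: poly_bounded_add (poly_bounded_mul bi (bc 5)).
    exact: poly_bounded_mul (bc 2) (poly_bounded_nest _ bi).
  apply: poly_bounded_add bfc _; apply: poly_bounded_add bfw.
  exact: poly_bounded_add (poly_bounded_mul poly_limit (bc 18)) (bc 18).
exists (fun n => g n + (2 * g n + 3)).
  exact: poly_bounded_add bg (poly_bounded_add (poly_bounded_mul (bc 2) bg) (bc 3)).
move=> w out; pose e0 : env := fun _ => 0.
pose m := size (rows (size (line d w))).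
have mE : m = limit (size w) by rewrite /m size_rows size_line.
have le_m : 0 + m <= limit (size w) by rewrite mE.
have le_m0 : m + 0 <= limit (size w) by rewrite mE addn0.
have [k run_k le_k] :
    runs writing (@ainit _ _ w) (g (size w)) (main_tapes w e0 (natbits m) 0%R out).
  have -> : @ainit gsym tname w = mk (fun _ => blank GY) (fun _ => blank GY)
      (fun _ => blank GY) (blank GY) (segment 0%R (bits GY w), 0%R) by apply: eq_atapes.
  rewrite /writing /g; apply: runs_seq; first exact: runs_setup_diffs.
  apply: runs_seq.
    by rewrite -size_input_cells; apply: runs_setup_loops.
  apply: runs_seq.
    by rewrite -size_input_cells -size_line; apply: runs_setup_vars.
  set T := mk _ _ _ _ _; have -> : T = main_tapes w e0 (natbits 0) 0%R [::].
    by apply: eq_atapes => *; rewrite /T /= ?subrr ?addr0.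
  apply: runs_seq (runc w e0 0 [::] _ le_m) _ => //.
  rewrite add0n; apply: runs_seq.
    by rewrite -mE; apply: runs_emit_sizes; rewrite /m size_rows.
  have := runw w e0 m (code_nat (2 * m) ++ code_nat m ++ code_nat m) _ le_m0.
  have outE u v x y : (u ++ v ++ v ++ x ++ y) ++ suffix = (u ++ v ++ v) ++ x ++ y ++ suffix.
    by rewrite -!catA.
  by rewrite addn0; cbv zeta; rewrite -outE; apply.
(* The output head ends past the output and moves by at most one cell per step, so the time bounds
   the length of the output. *)
have out_le : size out <= g (size w).
  have : `|((size (input_cells w))%:Z + (size out)%:Z - 0)%R|%N <= k := exec_head None run_k.
  by rewrite subr0 -PoszD absz_nat; lia.
split; first by lia.
have [T run_T TE] := @runs_rewind_out d Y GY w e0 (natbits m) 0%R out.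
exists T => //; apply: (@runs_le _ _ _ _ (g (size w) + (2 * size out + 3))); first by lia.
by apply: runs_seq run_T; exists k.
Qed.

End Layout.

(** * Exact selections and teams *)

Lemma sum_option (R : nmodType) (X : finType) (F : option X -> R) :
  (\sum_y F y = F None + \sum_x F (Some x))%R.
Proof.
rewrite (bigD1 None) //=; congr (_ + _)%R.
rewrite (reindex_omap Some id) => [|[x|]] //=.
by apply: eq_bigl => x; rewrite eqxx.
Qed.

Lemma sum_bool_option (R : nmodType) (X : finType) (F : bool * option X -> R) :
  (\sum_x F x = F (true, None) + \sum_x F (true, Some x) +
     (F (false, None) + \sum_x F (false, Some x)))%R.
Proof.
have -> : (\sum_x F x = \sum_x F (x.1, x.2))%R by apply: eq_bigr => -[].
rewrite -(pair_bigA _ (fun b y => F (b, y))) /= big_bool /=.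
by rewrite !sum_option.
Qed.

Section Balance.

Variables (X : finType) (consumed produced : X -> X -> bool) (supply : X -> bool).

(** The Boolean [c] tells whether the expert [(true, None)], which provides [supply], belongs to the
    team. *)
Definition balances (R : {set X}) (c : bool) : Prop := forall y,
  #|[set x in R | consumed x y]| = #|[set x in R | produced x y]| + c && supply y.

Hypothesis balances0 : forall R, balances R false -> R = set0.

(* The entries are even except that of the expert [(false, None)], so that a team
   with this expert and zero experts costs less than any inexact team without it. *)
Definition entry (x : bool * option X) (y : option X) : int :=
  match x, y with
  | (false, None), None => 1%R
  | (true, None), Some y => (-2 * (supply y)%:Z)%R
  | (true, Some x), Some y => (2 * ((consumed x y)%:Z - (produced x y)%:Z))%R
  | _, _ => 0%R
  end.

Definition cost (S : {set bool * option X}) : int :=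
  (\sum_y (\sum_(x in S) entry x y) ^+ 2)%R.

Definition chosen (S : {set bool * option X}) : {set X} := [set x | (true, Some x) \in S].

Implicit Types (R : {set X}) (S : {set bool * option X}).

Lemma sum_entry_None S : (\sum_(x in S) entry x None = ((false, None) \in S)%:Z)%R.
Proof.
rewrite big_mkcond sum_bool_option /= !if_same !big1 ?add0r ?addr0 => [|x|x]; rewrite ?if_same //.
by case: (_ \in S).
Qed.

Lemma sum_entry_Some S y : (\sum_(x in S) entry x (Some y) =
  2 * (#|[set x in chosen S | consumed x y]|%:Z - #|[set x in chosen S | produced x y]|%:Z
       - (((true, None) \in S) && supply y)%:Z))%R.
Proof.
have count (P : X -> bool) : (#|[set x in chosen S | P x]|%:Z =
    \sum_x if (true, Some x) \in S then (P x)%:Z else 0)%R.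
  rewrite -sum1_card (big_morph _ PoszD (erefl _)) big_mkcond.
  by apply: eq_bigr => x _; rewrite !inE; case: (_ \in S); case: (P x).
rewrite big_mkcond sum_bool_option /= !if_same.
rewrite [X in (_ + (_ + X))%R]big1 => [|x _]; last by rewrite if_same.
rewrite !addr0 !count -sumrB !mulrBr mulr_sumr addrC; congr (_ + _)%R.
  by apply: eq_bigr => x _; case: (_ \in S); rewrite ?subr0 ?mulr0.
by case: (_ \in S) => /=; rewrite ?mulr0 ?oppr0 // mulNr.
Qed.

Lemma intr_cost S :
  ((cost S)%:~R = \sum_y (\sum_(x in S) (entry x y)%:~R) ^+ 2 :> rat)%R.
Proof.
by rewrite /cost rmorph_sum; apply: eq_bigr => y _; rewrite rmorphXn /= rmorph_sum.
Qed.

Lemma cost_eq0 S : (cost S == 0%R) = [forall y, (\sum_(x in S) entry x y == 0)%R].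
Proof.
rewrite /cost psumr_eq0 => [|y _]; last exact: sqr_ge0.
apply/allP/forallP => [c0 y|c0 y _].
  by have := c0 y; rewrite mem_index_enum sqrf_eq0; apply.
by rewrite sqrf_eq0 c0.
Qed.

Lemma card_selection S : #|S| = ((true, None) \in S) + #|chosen S| +
  (((false, None) \in S) + #|[set x | (false, Some x) \in S]|).
Proof.
have count (b : bool) : #|[set x | (b, Some x) \in S]| = \sum_x ((b, Some x) \in S : nat).
  by rewrite -sum1_card big_mkcond; apply: eq_bigr => x _; rewrite inE; case: (_ \in S).
rewrite /chosen !count -sum1_card big_mkcond (sum_bool_option (R := nat)).
by congr (_ + _ + (_ + _)); try apply: eq_bigr => x _; case: (_ \in S).
Qed.

Lemma cost0_balances S : #|S| = #|X|.+1 -> cost S = 0%R -> exists R, balances R true.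
Proof.
move=> cardS /eqP; rewrite cost_eq0 => /forallP zero.
have A : (false, None) \notin S.
  by have := zero None; rewrite sum_entry_None; case: (_ \in S).
have bal : balances (chosen S) ((true, None) \in S).
  move=> y; have := zero (Some y); rewrite sum_entry_Some.
  by move: #|_| #|_| (nat_of_bool _) => a b c; lia.
(* Without the initial expert, balance leaves [chosen S] empty, and the [#|X|] zero experts are one
   too few for the team. *)
exists (chosen S); case: (boolP ((true, None) \in S)) => B; first by rewrite B in bal.
rewrite (negbTE B) in bal; move: cardS; rewrite card_selection (negbTE A) (negbTE B).
rewrite (balances0 bal) cards0 !add0n => cardS.
by have := max_card [set x | (false, Some x) \in S]; rewrite cardS ltnn.
Qed.

Lemma balances_cost0 R : balances R true ->
  exists2 S : {set bool * option X}, #|S| = #|X|.+1 & cost S = 0%R.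
Proof.
(* The zero experts indexed by the complement of [R] bring the team to the exact size, whatever the
   size of [R]. *)
move=> bal; pose S := [set x : bool * option X | match x with
  | (true, None) => true | (false, None) => false
  | (true, Some x) => x \in R | (false, Some x) => x \notin R end].
have SR : chosen S = R by apply/setP => x; rewrite !inE.
exists S.
  rewrite card_selection SR !inE /= add0n (_ : [set x | _] = ~: R).
    by rewrite -addnA cardsC.
  by apply/setP => x; rewrite !inE.
apply/eqP; rewrite cost_eq0; apply/forallP => -[y|]; last by rewrite sum_entry_None inE.
by rewrite sum_entry_Some SR bal inE /=; apply/eqP; lia.
Qed.

Lemma cost_signal S : (false, None) \in S -> (1 <= cost S)%R.
Proof.
move=> A; rewrite /cost sum_option sum_entry_None A lerDl sumr_ge0 // => y _; exact: sqr_ge0.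
Qed.

Lemma cost_no_signal S : (false, None) \notin S -> cost S != 0%R -> (4 <= cost S)%R.
Proof.
move=> A; rewrite cost_eq0 negb_forall => /existsP[[y|]]; last first.
  by rewrite sum_entry_None (negbTE A).
move=> ne; rewrite /cost sum_option (bigD1 y) //=.
apply: (@le_trans _ _ ((\sum_(x in S) entry x (Some y)) ^+ 2)%R).
  by move: ne; rewrite sum_entry_Some; move: (_ - _ - _)%R => z; nia.
rewrite addrCA lerDl addr_ge0 ?sqr_ge0 // sumr_ge0 // => z _; exact: sqr_ge0.
Qed.

Lemma cost_fillers : exists2 S : {set bool * option X}, #|S| = #|X|.+1 & cost S = 1%R.
Proof.
pose S := [set x : bool * option X | ~~ x.1].
have S0 : chosen S = set0 by apply/setP => x; rewrite !inE.
exists S.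
  by rewrite card_selection S0 cards0 !inE /= (_ : [set x | _] = setT) ?cardsT //;
     apply/setP => x; rewrite !inE.
rewrite /cost sum_option sum_entry_None inE /= big1 => [|y _]; first by rewrite addr0.
by rewrite sum_entry_Some inE S0 (_ : [set x in _ | consumed x y] = set0)
     1?(_ : [set x in _ | produced x y] = set0) ?cards0 //; apply/setP => x; rewrite !inE.
Qed.

Lemma optimal_signal S : #|S| = #|X|.+1 ->
  (forall S' : {set bool * option X}, #|S'| = #|X|.+1 -> (cost S <= cost S')%R) ->
  (exists R, balances R true) <-> (false, None) \notin S.
Proof.
move=> cardS opt; split=> [[R /balances_cost0[S' cardS' cost0]]|A].
  apply/negP => /cost_signal; have := opt _ cardS'; rewrite cost0; lia.
case: (eqVneq (cost S) 0%R) => [/(cost0_balances cardS)//|/(cost_no_signal A)].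
by have [S' cardS' cost1] := cost_fillers; have := opt _ cardS'; rewrite cost1; lia.
Qed.

End Balance.

(** * Computations as selections *)

(** In the encoding of a run each count for a state, symbol, head or action is 0 or 1, with a single
    candidate expert; this reduces such a count to a membership test. *)
Lemma card_le1_mem (X : finType) (A : {set X}) x0 :
  {in A, forall x, x = x0} -> #|A| = (x0 \in A).
Proof.
move=> A1; case: (boolP (x0 \in A)) => x0A.
  rewrite (_ : A = [set x0]) ?cards1 //; apply/setP => x; rewrite inE.
  by apply/idP/eqP => [/A1|->].
by apply: eq_card0 => x; apply/negbTE; apply: contraNN x0A => xA; rewrite -(A1 x xA).
Qed.

Section LineCells.

Variables (d : nat) (w : word).

Definition margin : nat := size (input_cells w) ^ d.+1.
Definition origin : nat := margin.+1.

Lemma nth_input_cells k :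
  nth empty_cell (input_cells w) k = (false, k == 0, nth None (map Some w) k).
Proof.
case: k => [|k] /=; first by case: w.
rewrite nth_cat size_map; case: ltnP => [lt|le].
  by rewrite (nth_map false) // nth_behead (nth_map false) //; move: lt; rewrite size_behead; lia.
rewrite [nth None _ _]nth_default; last by move: le; rewrite size_map size_behead; lia.
by case: (_ - _) => [|[|n]] //=; rewrite nth_nil.
Qed.

Lemma cell_atE i : cell_at d w i =
  if i == 0 then (true, false, None) else
  if i < origin then empty_cell else
  (false, i == origin, nth None (map Some w) (i - origin)).
Proof.
rewrite /cell_at /line /origin /margin; move: (_ ^ _) => m; case: i => [//|i].
rewrite eqSS -[nth _ _ _]/(nth empty_cell
  (nseq m empty_cell ++ input_cells w ++ nseq m empty_cell) i).
rewrite nth_cat nth_nseq size_nseq if_same !ltnS; case: ltnP => // le.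
rewrite nth_cat nth_nseq if_same subSS (_ : (i == m) = (i - m == 0)); last by lia.
rewrite -nth_input_cells; case: ltnP => // ge; by rewrite nth_default.
Qed.

Lemma cell_first i : (cell_at d w i).1.1 = (i == 0).
Proof. by rewrite cell_atE; case: eqP => // _; case: ifP. Qed.

Lemma cell_origin i : (cell_at d w i).1.2 = (i == origin).
Proof.
rewrite cell_atE; case: eqP => [->|_] //; case: ifP => //= lt.
by rewrite ltn_eqF.
Qed.

End LineCells.

Section Tokens.

Variables (M : machine) (d : nat) (w : word).

Notation Q := (state M).
Notation I := 'I_(extra M).+1.
Notation Sym := (symbol (aux M)).

(* States before and after the transition, [None] being reached by halting in an
   accepting state; symbols read; symbols written and moves. *)
Definition transition : finType :=
  (option Q * option Q * {ffun I -> Sym} * {ffun I -> Sym * move})%type.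

Definition src (t : transition) : option Q := t.1.1.1.
Definition tgt (t : transition) : option Q := t.1.1.2.
Definition reads (t : transition) := t.1.2.
Definition writes (t : transition) := t.2.

(** The case [None, None] lets a run that has halted go on idly: the state produced by halting must
    be consumed at the next time, and so on up to the end of the line. *)
Definition valid (t : transition) : bool :=
  match src t, tgt t with
  | Some q, Some q' => (q', writes t) \in trans q (reads t)
  | Some q, None => (trans q (reads t) == set0) && (q \in accepting M)
  | None, None => true
  | None, Some _ => false
  end.

(* An expert at time [s] and position [j] is a transition made at time [s], or
   tells for a tape the symbol at position [j] at time [s] and, if the head is
   there, what it does. *)
Definition event : finType := (transition + (I * Sym * option (Sym * move)))%type.

(* A round at time [s] and position [j] balances, for the state, the actions
   of the heads, the symbols and the presence of heads, what is expected at time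
   [s] with what the previous step provides; the last kind counts haltings. *)
Definition resource : finType :=
  (option Q + (I * Sym * (Sym * move)) + (I * Sym) + I + unit)%type.

(* Experts and rounds have the same kinds, so that there are as many rounds as
   team members; the experts [inr _] and the invalid transitions are excluded
   by the rounds [inl _]. *)
Definition kind : finType := (event + resource)%type.

Notation InState q := (inl (inl (inl (inl q)))).
Notation InAction a := (inl (inl (inl (inr a)))).
Notation InSymbol a := (inl (inl (inr a))).
Notation InHead h := (inl (inr h)).
Notation InHalt := (inr tt).

Definition after (a : Sym) (x : option (Sym * move)) : Sym :=
  if x is Some (b, _) then b else a.

(* [rt m] means that the time of the round is that of the expert offset by [m],
   and [rj m] means the same for the positions. *)
Definition consumes (k r : kind) (rt rj : move -> bool) : bool :=
  match k, r with
  | inl (inl t), inl _ => ~~ valid t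
  | inr _, inl _ => true
  | inl (inl t), inr (InState q) => rt None && (src t == q)
  | inl (inl t), inr InHalt => (src t != None) && (tgt t == None)
  | inl (inr (h', a', x)), inr (InAction (h, a, b)) =>
      [&& rt None, h' == h, a' == a & x == Some b]
  | inl (inr (h', a', x)), inr (InSymbol (h, a)) => [&& rt None, rj None, h' == h & a' == a]
  | inl (inr (h', a', x)), inr (InHead h) => [&& rt None, rj None, h' == h & isSome x]
  | _, _ => false
  end.

(** States, symbols and heads are produced one time step before they are consumed, but an action is
    produced by the transition made at the very time when a cell expert consumes it. The action
    rounds thus force the tapes to obey the transition. *)
Definition produces (k r : kind) (rt rj : move -> bool) : bool :=
  match k, r with
  | inl (inl t), inr (InState q) => rt (Some true) && (tgt t == q)
  | inl (inl t), inr (InAction (h, a, b)) =>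
      [&& rt None, reads t h == a & writes t h == b]
  | inl (inr (h', a', x)), inr (InSymbol (h, a)) =>
      [&& rt (Some true), rj None, h' == h & after a' x == a]
  | inl (inr (h', a', x)), inr (InHead h) =>
      [&& rt (Some true), h' == h & if x is Some (_, m) then rj m else false]
  | _, _ => false
  end.

Definition initial_symbol (h : I) (c : cell) : Sym :=
  if h == ord0 then omap inl c.2 else None.

(** [ct] is the cell of the line numbered by the time of the round and [cj] the one numbered by its
    position, so the flags pick out time 0 and the origin. A unit of halting is supplied whatever
    the time, and [consumes] ignores times there: exactly one halt is required in the whole run. *)
Definition supplied (r : kind) (ct cj : cell) : bool :=
  match r with
  | inr (InState q) => ct.1.1 && (q == Some (start M))
  | inr (InSymbol (h, a)) => ct.1.1 && (a == initial_symbol h cj)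
  | inr (InHead h) => ct.1.1 && cj.1.2
  | inr InHalt => true
  | _ => false
  end.

Definition token_weight (k r : kind) (rt rj : move -> bool) : int :=
  (2 * ((consumes k r rt rj)%:Z - (produces k r rt rj)%:Z))%R.

Definition token_unit_weight (r : kind) (ct cj : cell) : int :=
  (-2 * (supplied r ct cj)%:Z)%R.

Lemma token_weight_in k r f g : token_weight k r f g \in weights.
Proof. by rewrite /token_weight; case: (consumes _ _ _ _); case: (produces _ _ _ _). Qed.

Lemma token_unit_weight_in r c c' : token_unit_weight r c c' \in weights.
Proof. by rewrite /token_unit_weight; case: (supplied _ _ _). Qed.

Notation J := (size (line d w)).
Definition site : finType := ('I_J * 'I_J * kind)%type.

Definition consumes_at (x y : site) : bool :=
  consumes x.2 y.2 (at_offset x.1.1 y.1.1) (at_offset x.1.2 y.1.2).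
Definition produces_at (x y : site) : bool :=
  produces x.2 y.2 (at_offset x.1.1 y.1.1) (at_offset x.1.2 y.1.2).
Definition supplied_at (y : site) : bool := supplied y.2 (cell_at d w y.1.1) (cell_at d w y.1.2).

Notation balanced := (balances consumes_at produces_at supplied_at).

Definition selection_exists : Prop := exists R, balanced R true.

Lemma at_offset0 (s s' : nat) : at_offset s s' None = (s' == s).
Proof. by rewrite /at_offset addr0. Qed.

Lemma at_offset1 (s s' : nat) : at_offset s s' (Some true) = (s' == s.+1).
Proof. by rewrite /at_offset /= -PoszD addn1. Qed.

(** Induction on time: a selected event consumes a state or a symbol that only experts of earlier
    times produce, and a selected resource consumes in a round where nothing is produced. *)
Lemma balanced0 R : balanced R false -> R = set0.
Proof.
move=> balR; suff none n (x : site) : x.1.1 < n -> x \notin R.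
  by apply/setP => x; rewrite inE; apply/negbTE; apply: none (ltn_ord _).
elim: n x => // n IH -[[s j] k] /= lt; apply/negP => xR.
suff [r rx rn] : exists2 r : kind, consumes_at (s, j, k) (s, j, r) &
    forall x : site, produces_at x (s, j, r) -> x.1.1 < s.
  have := balR (s, j, r); rewrite addn0 => card_eq.
  have : 0 < #|[set x in R | consumes_at x (s, j, r)]|.
    by apply/card_gt0P; exists (s, j, k); rewrite inE xR.
  rewrite card_eq => /card_gt0P[x]; rewrite inE => /andP[xR' /rn lts].
  by have /negP := IH x (leq_trans lts lt).
case: k xR => [[t|[[h a] x]]|r] xR.
- exists (inr (InState (src t))); first by rewrite /consumes_at /= at_offset0 !eqxx.
  move=> [[s1 j1] [[t1|[[h1 a1] x1]]|r1]] //; rewrite /produces_at /= at_offset1.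
  by case/andP => /eqP->.
- exists (inr (InSymbol (h, a))); first by rewrite /consumes_at /= !at_offset0 !eqxx.
  move=> [[s1 j1] [[t1|[[h1 a1] x1]]|r1]] //; rewrite /produces_at /= at_offset1.
  by case/andP => /eqP->.
- exists (inl (inr (ord0, None, None))) => // -[[s1 j1] [[t1|[[h1 a1] x1]]|r1]] //.
Qed.

Notation tapes := (I -> atape (aux M)).

Definition in_range (T : tapes) : Prop := forall h, exists p : 'I_J, (T h).2 = p%:Z%R.

Definition apply_transition (t : transition) (T : tapes) : tapes :=
  fun h => aact (writes t h) (T h).

Definition head_action (T : tapes) (t : transition) h (j : 'I_J) : option (Sym * move) :=
  if j%:Z%R == (T h).2 then Some (writes t h) else None.

(* At time [s], the selection [R] makes the transition [t] from the tapes [T]. *)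
Definition follows (R : {set site}) (s : 'I_J) (T : tapes) (t : transition) : Prop :=
  (exists jt, forall j t', ((s, j, inl (inl t')) \in R) = (j == jt) && (t' == t)) /\
  (forall j h a x, ((s, j, inl (inr (h, a, x))) \in R) =
     (a == (T h).1 j%:Z%R) && (x == head_action T t h j)).

Definition token (q : option Q) (T : tapes) (j : 'I_J) (r : kind) : bool :=
  match r with
  | inr (InState q') => q == q'
  | inr (InSymbol (h, a)) => (T h).1 j%:Z%R == a
  | inr (InHead h) => j%:Z%R == (T h).2
  | _ => false
  end.

Definition is_token (r : kind) : bool :=
  match r with
  | inr (InState _) | inr (InSymbol _) | inr (InHead _) => true
  | _ => false
  end.

Lemma follows_cons R s T t j r : follows R s T t -> is_token r ->
  #|[set x in R | consumes_at x (s, j, r)]| = token (src t) T j r.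
Proof.
move=> [[jt fz] fw]; case: r => [//|[[[[q|//]|[h a]]|h]|//]] _.
- rewrite (@card_le1_mem _ _ (s, jt, inl (inl t))).
    by rewrite inE fz !eqxx /consumes_at /= at_offset0 eqxx.
  move=> [[s1 j1] [[t1|[[h1 a1] x1]]|r1]]; rewrite inE /consumes_at ?andbF //= at_offset0.
  by case/and3P => + /eqP/val_inj es; rewrite -es fz => /andP[/eqP-> /eqP->].
- rewrite (@card_le1_mem _ _ (s, j, inl (inr (h, (T h).1 j%:Z%R, head_action T t h j)))).
    by rewrite inE fw !eqxx /consumes_at /= !at_offset0 !eqxx.
  move=> [[s1 j1] [[t1|[[h1 a1] x1]]|r1]]; rewrite inE /consumes_at ?andbF //= !at_offset0.
  case/and5P => + /eqP/val_inj es /eqP/val_inj ej /eqP eh _.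
  by rewrite -es -ej eh fw => /andP[/eqP-> /eqP->].
- rewrite (@card_le1_mem _ _ (s, j, inl (inr (h, (T h).1 j%:Z%R, head_action T t h j)))).
    rewrite inE fw !eqxx /consumes_at /= !at_offset0 !eqxx /head_action.
    by case: (_ == _).
  move=> [[s1 j1] [[t1|[[h1 a1] x1]]|r1]]; rewrite inE /consumes_at ?andbF //= !at_offset0.
  case/and5P => + /eqP/val_inj es /eqP/val_inj ej /eqP eh _.
  by rewrite -es -ej eh fw => /andP[/eqP-> /eqP->].
Qed.

Lemma follows_prod R (s s' : 'I_J) T t j r : in_range T -> s' = s.+1 :> nat ->
  follows R s T t -> is_token r ->
  #|[set x in R | produces_at x (s', j, r)]| = token (tgt t) (apply_transition t T) j r.
Proof.
move=> rangeT s'E [[jt fz] fw].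
have time s1 : at_offset s1 s' (Some true) -> s = s1 :> nat.
  by rewrite at_offset1 s'E eqSS => /eqP.
have time_s : at_offset s s' (Some true) by rewrite at_offset1 s'E.
case: r => [//|[[[[q|//]|[h a]]|h]|//]] _.
- rewrite (@card_le1_mem _ _ (s, jt, inl (inl t))).
    by rewrite inE fz !eqxx /produces_at /= time_s.
  move=> [[s1 j1] [[t1|[[h1 a1] x1]]|r1]]; rewrite inE /produces_at ?andbF //=.
  by case/and3P => + /time/val_inj es; rewrite -es fz => /andP[/eqP-> /eqP->].
- rewrite (@card_le1_mem _ _ (s, j, inl (inr (h, (T h).1 j%:Z%R, head_action T t h j)))).
    rewrite inE fw !eqxx /produces_at /= at_offset0 time_s !eqxx /= /head_action.
    by case: (Posz j == (T h).2); case: (writes t h).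
  move=> [[s1 j1] [[t1|[[h1 a1] x1]]|r1]]; rewrite inE /produces_at ?andbF //= at_offset0.
  case/and5P => + /time/val_inj es /eqP/val_inj ej /eqP eh _.
  by rewrite -es -ej eh fw => /andP[/eqP-> /eqP->].
(* A head is produced only by the expert of the cell under it, so this cell must be on the line. *)
have [p pE] := rangeT h.
rewrite (@card_le1_mem _ _ (s, p, inl (inr (h, (T h).1 p%:Z%R, Some (writes t h))))).
  rewrite inE fw eqxx /head_action pE eqxx eqxx /produces_at /= time_s eqxx /=.
  by rewrite pE; case: (writes t h).
move=> [[s1 j1] [[t1|[[h1 a1] x1]]|r1]]; rewrite inE /produces_at ?andbF //=.
case/and4P => + /time/val_inj es /eqP eh; rewrite -es eh fw /head_action pE.
case: (eqVneq j1 p) => [->|ne].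
  by rewrite eqxx => /andP[/eqP-> /eqP->].
by rewrite ifF => [/andP[_ /eqP->]//|]; apply/negbTE.
Qed.

(** Both counts tell whether [a] is the symbol under the head and [b] the action of [t]: the
    consumer is the expert of that cell, the producer is the transition. *)
Lemma follows_action R (s : 'I_J) T t j (h : I) a b : in_range T -> follows R s T t ->
  reads t h = ascan (T h) ->
  #|[set x in R | consumes_at x (s, j, inr (InAction (h, a, b)))]| =
  #|[set x in R | produces_at x (s, j, inr (InAction (h, a, b)))]|.
Proof.
move=> rangeT [[jt fz] fw] readE; have [p pE] := rangeT h.
rewrite (@card_le1_mem _ _ (s, p, inl (inr (h, (T h).1 p%:Z%R, Some (writes t h))))).
  rewrite (@card_le1_mem _ _ (s, jt, inl (inl t))).
    rewrite !inE fz fw !eqxx /head_action pE eqxx /consumes_at /produces_at /= !at_offset0 !eqxx /=.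
    by rewrite readE /ascan pE.
  move=> [[s1 j1] [[t1|[[h1 a1] x1]]|r1]]; rewrite inE /produces_at ?andbF //= at_offset0.
  by case/and3P => + /eqP/val_inj es _; rewrite -es fz => /andP[/eqP-> /eqP->].
move=> [[s1 j1] [[t1|[[h1 a1] x1]]|r1]]; rewrite inE /consumes_at ?andbF //= at_offset0.
case/and5P => + /eqP/val_inj es /eqP eh _ xb; rewrite -es eh fw /head_action pE.
case: (eqVneq j1 p) => [->|ne]; first by rewrite eqxx => /andP[/eqP-> /eqP->].
by rewrite ifF => [/andP[_ /eqP x0]|]; [rewrite x0 in xb|apply/negbTE].
Qed.

Lemma produces_at_start (x : site) (s j : 'I_J) r : s = 0 :> nat -> is_token r ->
  produces_at x (s, j, r) = false.
Proof.
move=> s0; case: x => [[s1 j1] [[t|[[h1 a1] x1]]|r1]];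
by case: r => [//|[[[[q|//]|[h a]]|h]|//]] _; rewrite /produces_at //= at_offset1 s0.
Qed.

(** The counts at one time determine all the experts of that time. The state gives a unique
    transition, the symbols one expert per cell, the heads say which of these experts act, and the
    action rounds identify what they do with what the transition prescribes. *)
Lemma tokens_follow R (s : 'I_J) T q : balanced R true -> in_range T ->
  (forall j r, is_token r ->
     #|[set x in R | consumes_at x (s, j, r)]| = token (Some q) T j r) ->
  exists t, [/\ valid t, src t = Some q, forall h, reads t h = ascan (T h) &
    follows R s T t].
Proof.
move=> balR rangeT tok.
have tok_mem j r x : is_token r -> x \in R -> consumes_at x (s, j, r) -> token (Some q) T j r.
  move=> tr xR cx; have : 0 < #|[set x in R | consumes_at x (s, j, r)]|.
    by apply/card_gt0P; exists x; rewrite inE xR.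
  by rewrite tok //; case: (token _ _ _ _).
have tok_ex j r : is_token r -> token (Some q) T j r ->
    exists2 x, x \in R & consumes_at x (s, j, r).
  move=> tr tt; have : 0 < #|[set x in R | consumes_at x (s, j, r)]| by rewrite tok // tt.
  by case/card_gt0P => x; rewrite inE => /andP[]; exists x.
have tok_uniq j r x x' : is_token r -> x \in R -> x' \in R ->
    consumes_at x (s, j, r) -> consumes_at x' (s, j, r) -> x = x'.
  move=> tr xR x'R cx cx'; have : #|[set x in R | consumes_at x (s, j, r)]| <= 1.
    by rewrite tok //; case: (token _ _ _ _).
  by move/card_le1_eqP; apply; rewrite inE ?xR ?x'R.
have [[[s1 jt] k1] xR] := tok_ex s (inr (InState (Some q))) erefl (eqxx _).
case: k1 xR => [[t|[[h1 a1] x1]]|r1] //= tR; rewrite /consumes_at /= at_offset0.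
move=> /andP[/eqP/val_inj es /eqP srct]; subst s1.
have uniq_t j t' : (s, j, inl (inl t')) \in R -> j = jt /\ t' = t.
  move=> t'R; have := tok_mem s (inr (InState (src t'))) _ erefl t'R.
  rewrite /consumes_at /= at_offset0 !eqxx => /(_ erefl)/eqP[srct'].
  have := tok_uniq s (inr (InState (Some q))) _ _ erefl t'R tR.
  by rewrite /consumes_at /= !at_offset0 eqxx -srct' srct eqxx => /(_ erefl erefl)[-> ->].
have act h : exists p : 'I_J, [/\ (T h).2 = p%:Z%R, reads t h = ascan (T h) &
    (s, p, inl (inr (h, (T h).1 p%:Z%R, Some (writes t h)))) \in R].
  have [p pE] := rangeT h; exists p.
  have [[[s1 j1] k1]] := tok_ex p (inr (InHead h)) erefl (introT eqP (esym pE)).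
  case: k1 => [[t'|[[h1 a1] [b|]]]|r1] // xR; rewrite /consumes_at /= ?andbF // !at_offset0.
  case/and4P => /eqP/val_inj es /eqP/val_inj ej /eqP eh _; subst s1 j1 h1.
  have := tok_mem p (inr (InSymbol (h, a1))) _ erefl xR.
  rewrite /consumes_at /= !at_offset0 !eqxx => /(_ erefl)/eqP a1E; subst a1.
  (* The action consumed under the head has to be produced by a transition made at time [s], and [t]
     is the only one. *)
  have := balR (s, p, inr (InAction (h, (T h).1 p%:Z%R, b))); rewrite addn0 => cardE.
  have : 0 < #|[set x in R | consumes_at x (s, p, inr (InAction (h, (T h).1 p%:Z%R, b)))]|.
    by apply/card_gt0P; exists (s, p, inl (inr (h, (T h).1 p%:Z%R, Some b)));
       rewrite inE xR /consumes_at /= at_offset0 !eqxx.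
  rewrite cardE => /card_gt0P[[[s1 j1] [[t'|[[h1 a1] x1]]|r1]]];
    rewrite inE /produces_at ?andbF //=.
  rewrite at_offset0 => /and4P[t'R /eqP/val_inj es /eqP rE /eqP wE]; subst s1.
  by have [_ tE] := uniq_t _ _ t'R; subst t'; rewrite rE /ascan pE wE.
exists t; split=> //.
(* An invalid transition would consume in a round where nothing is produced or supplied. *)
- have := balR (s, s, inl (inl t)); rewrite !addn0 => card0.
  apply: contraT => nv.
  have : 0 < #|[set x in R | consumes_at x (s, s, inl (inl t))]|.
    by apply/card_gt0P; exists (s, jt, inl (inl t)); rewrite inE tR /consumes_at.
  by rewrite card0 => /card_gt0P[[[s1 j1] [[t'|[[h1 a1] x1]]|r1]]]; rewrite inE andbF.
- by move=> h; have [p []] := act h.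
split.
  exists jt => j t'; apply/idP/andP => [/uniq_t[-> ->]|[/eqP-> /eqP->]] //.
move=> j h a x.
have [p [pE _ pR]] := act h.
have mem_action : (s, j, inl (inr (h, (T h).1 j%:Z%R, head_action T t h j))) \in R.
  rewrite /head_action; case: eqP => [jE|jne].
    by move: jE; rewrite pE => -[/val_inj->].
  (* Away from the head, the expert of the cell cannot act, since it would consume a head that is
     not there. *)
  have [[[s1 j1] k1]] := tok_ex j (inr (InSymbol (h, (T h).1 j%:Z%R))) erefl (eqxx _).
  case: k1 => [[t'|[[h1 a1] x1]]|r1] // xR; rewrite /consumes_at /= ?andbF // !at_offset0.
  case/and4P => /eqP/val_inj es /eqP/val_inj ej /eqP eh /eqP a1E; subst s1 j1 h1 a1.
  case: x1 xR => // b xR; have := tok_mem j (inr (InHead h)) _ erefl xR.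
  by rewrite /consumes_at /= !at_offset0 !eqxx => /(_ erefl)/eqP.
apply/idP/andP => [xR|[/eqP-> /eqP->]] //.
have := tok_mem j (inr (InSymbol (h, a))) _ erefl xR.
rewrite /consumes_at /= !at_offset0 !eqxx => /(_ erefl)/eqP aE; subst a.
have := tok_uniq j (inr (InSymbol (h, (T h).1 j%:Z%R))) _ _ erefl xR mem_action.
by rewrite /consumes_at /= !at_offset0 !eqxx => /(_ erefl erefl)[->].
Qed.

Definition trepresents (c : config M) (T : tapes) : Prop :=
  forall h, represents (c.2 h) (T h).

Definition initial_tapes : tapes := fun h =>
  (fun z => if z is Posz i then initial_symbol h (cell_at d w i) else None, origin d w : int).

Lemma initial_trepresents : trepresents (init M w) initial_tapes.
Proof.
have left h z : (z < (origin d w)%:Z)%R -> (initial_tapes h).1 z = None.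
  rewrite /initial_tapes /initial_symbol; case: z => [i|//] lt /=.
  rewrite cell_atE; case: (i == 0); first by case: (h == ord0).
  by move: lt; rewrite ltz_nat => ->; case: (h == ord0).
move=> h k; split; last first.
  rewrite left ?ffunE ?nth_nil //= ltrBlDr ltrDl; lia.
rewrite -[(_ + _)%R]/(Posz (origin d w + k)) ffunE /=.
have cellE : (cell_at d w (origin d w + k)).2 = nth None (map Some w) k.
  by rewrite cell_atE -[_ == 0]/false ltnNge leq_addr addnC addnK.
rewrite /initial_symbol cellE; case: (h == ord0); last by rewrite nth_nil.
case: (ltnP k (size w)) => [lt|le]; last by rewrite !nth_default ?size_map.
by rewrite !(nth_map false).
Qed.

Lemma trepresents_reads c T t : trepresents c T -> (forall h, reads t h = ascan (T h)) ->
  [ffun h => scan (c.2 h)] = reads t.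
Proof.
by move=> rep rE; apply/ffunP => h; rewrite ffunE rE; apply: represents_scan.
Qed.

Lemma valid_step c T t q : trepresents c T -> (forall h, reads t h = ascan (T h)) ->
  src t = Some c.1 -> tgt t = Some q -> valid t ->
  exists c', [/\ step c c', c'.1 = q & trepresents c' (apply_transition t T)].
Proof.
move=> rep rE st tt; rewrite /valid st tt => vt.
exists (q, [ffun h => act (writes t h) (c.2 h)]); split=> //.
  by apply/existsP; exists (q, writes t); rewrite /moves (trepresents_reads rep rE) vt eqxx.
by move=> h; rewrite ffunE; apply: represents_act.
Qed.

Lemma valid_halt c T t : trepresents c T -> (forall h, reads t h = ascan (T h)) ->
  src t = Some c.1 -> tgt t = None -> valid t -> halted c /\ c.1 \in accepting M.
Proof.
move=> rep rE st tt; rewrite /valid st tt => /andP[tr0 acc]; split=> //.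
by rewrite /halted /moves (trepresents_reads rep rE).
Qed.

Lemma lengthE : J = (margin d w + (input_length (size w) + margin d w)).+1.
Proof. by rewrite size_line /line_length -size_input_cells. Qed.

Lemma in_range_near (T : tapes) (n : nat) :
  (forall h, `|(T h).2 - Posz (origin d w)|%N <= n) -> n <= margin d w -> in_range T.
Proof.
move=> near le_n h; have := near h; case: (T h) => f z /= nearz.
have lt : `|z|%N < J.
  by rewrite lengthE /input_length; move: nearz le_n; rewrite /origin; lia.
by exists (Ordinal lt) => /=; move: nearz le_n; rewrite /origin; lia.
Qed.

Variable bound : nat.
Hypothesis runs_bound : runs_within M w bound.
Hypothesis le_bound : bound <= margin d w.

(* Rebuilds the computation from the selection, one step at a time, until it
   halts. *)
Lemma balanced_accepts R : balanced R true -> accepts M w.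
Proof.
move=> balR.
pose reached (s : 'I_J) := exists cs T, [/\ path (@step M) (init M w) cs, size cs = s,
  trepresents (last (init M w) cs) T,
  forall h, `|(T h).2 - Posz (origin d w)|%N <= s &
  forall j r, is_token r -> #|[set x in R | consumes_at x (s, j, r)]| =
     token (Some (last (init M w) cs).1) T j r].
(* Any partial computation has at most [bound] steps, hence fewer than a margin can absorb, and its
   heads are still on the line. *)
have range s cs T : path (@step M) (init M w) cs -> size cs = s ->
    (forall h, `|(T h).2 - Posz (origin d w)|%N <= s) -> in_range T.
  move=> pcs sz near; apply: in_range_near near _.
  by apply: leq_trans le_bound; rewrite -sz; apply: runs_bound.
(* The alternative is needed because the run may accept before time [s]. *)
have all_reached n (s : 'I_J) : s = n :> nat -> accepts M w \/ reached s.
  elim: n s => [|n IH] s sE.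
    right; exists [::], initial_tapes; split=> //=; first exact: initial_trepresents.
      by move=> h; rewrite subrr.
    move=> j r tr; rewrite balR (_ : [set x in R | _] = set0) ?cards0; last first.
      by apply/setP => x; rewrite !inE produces_at_start ?andbF.
    case: r tr => [//|[[[[q|//]|[h a]]|h]|//]] _; rewrite /supplied_at /= cell_first sE eqxx /=.
    - by rewrite eq_sym.
    - by rewrite eq_sym.
    - by rewrite cell_origin eqz_nat.
  have lt : n < J by rewrite -sE ltnW.
  have [|] := IH (Ordinal lt) erefl; first by left.
  move=> [cs [T [pcs szcs rep near tok]]].
  have rangeT := range _ _ _ pcs szcs near.
  have [t [vt st rt fol]] := tokens_follow balR rangeT tok.
  case tt : (tgt t) => [q|]; last first.
    by left; exists cs; have [] := valid_halt rep rt st tt vt.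
  right; have [c' [stepc c'q rep']] := valid_step rep rt st tt vt.
  exists (rcons cs c'), (apply_transition t T); rewrite rcons_path last_rcons size_rcons.
  split=> //; first by rewrite pcs.
  - by rewrite szcs sE.
  - move=> h; have := near h; have := offset_le1 (writes t h).2.
    rewrite sE /apply_transition /aact /=; case: (T h) => f z /=; lia.
  move=> j r tr; rewrite balR (follows_prod _ rangeT _ fol tr) ?sE // tt c'q.
  rewrite (_ : supplied_at _ = false) ?addn0 //.
  by case: r tr => [//|[[[[q1|//]|[h a]]|h]|//]] _; rewrite /supplied_at /= cell_first sE.
have J0 : 0 < J by [].
(* Any halting round provides a selected transition that halts, at some time [s]. If the run reaches
   [s], this is the transition that it makes there. *)
have := balR (Ordinal J0, Ordinal J0, inr InHalt).
rewrite [X in _ = X + _](_ : _ = 0); last first.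
  by apply: eq_card0 => -[[s1 j1] [[t1|[[h1 a1] x1]]|r1]]; rewrite !inE andbF.
rewrite /supplied_at /= => card1.
have : 0 < #|[set x in R | consumes_at x (Ordinal J0, Ordinal J0, inr InHalt)]| by rewrite card1.
case/card_gt0P => -[[s j] [[t|[[h1 a1] x1]]|r1]]; rewrite inE /consumes_at ?andbF //=.
case/and3P => tR src_t /eqP tgt_t.
have [//|[cs [T [pcs szcs rep near tok]]]] := all_reached _ s erefl.
have [t' [vt' st' rt' [[jt fz] _]]] := tokens_follow balR (range _ _ _ pcs szcs near) tok.
move: tR; rewrite fz => /andP[_ /eqP tE]; rewrite tE in tgt_t.
by exists cs; have [] := valid_halt rep rt' st' tgt_t vt'.
Qed.

Definition idle (T : tapes) (q : option Q) : transition :=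
  (q, None, [ffun h => ascan (T h)], [ffun h => (ascan (T h), None)]).

(** The run is prolonged for ever by idle transitions, so that it can be read at every time of the
    line; it still halts exactly once, after its last step. *)
Lemma run_sequence c cs T : trepresents c T -> path (@step M) c cs ->
  halted (last c cs) -> (last c cs).1 \in accepting M ->
  exists (Ts : nat -> tapes) (ts : nat -> transition), [/\ Ts 0 = T, src (ts 0) = Some c.1,
    forall s, [/\ Ts s.+1 = apply_transition (ts s) (Ts s),
      tgt (ts s) = src (ts s.+1), valid (ts s) & forall h, reads (ts s) h = ascan (Ts s h)] ,
    (forall s, ((src (ts s) != None) && (tgt (ts s) == None)) = (s == size cs)) &
    forall s h, `|(Ts s h).2 - (T h).2|%N <= size cs].
Proof.
elim: cs c T => [|c' cs IH] c T rep /=.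
  move=> _ halt acc; exists (fun _ => T), (fun s => idle T (if s is 0 then Some c.1 else None)).
  have keepT q : apply_transition (idle T q) T = T.
    by apply: functional_extensionality => h; rewrite /apply_transition ffunE aact_keep.
  split=> //; [|by case|by move=> s h; rewrite subrr].
  move=> s; rewrite keepT; split=> //; last by move=> h; rewrite ffunE.
  case: s => [|s] //; rewrite /valid /=.
  rewrite -(trepresents_reads rep) => [|h]; last by rewrite ffunE.
  by rewrite acc andbT; apply: halt.
case/andP => /existsP[tr /andP[trc /eqP c'E]] pcs halt acc.
pose t : transition := (Some c.1, Some tr.1, [ffun h => ascan (T h)], tr.2).
have rep' : trepresents c' (apply_transition t T).
  by move=> h; rewrite c'E ffunE; apply: represents_act.
have [Ts [ts [Ts0 ts0 runs halts near]]] := IH c' _ rep' pcs halt acc.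
exists (fun s => if s is s'.+1 then Ts s' else T), (fun s => if s is s'.+1 then ts s' else t).
split=> //.
- case=> [|s]; last exact: runs.
  split=> //; [by rewrite ts0 c'E| |by move=> h; rewrite ffunE].
  move: trc; rewrite /moves /valid /= -surjective_pairing.
  by rewrite (trepresents_reads (t := t) rep) // => h; rewrite ffunE.
- by case=> [|s]; rewrite ?halts.
case=> [|s] h; first by rewrite subrr.
have := near s h; have := offset_le1 (writes t h).2.
by rewrite /apply_transition /aact; case: (T h) => f z /=; lia.
Qed.

Lemma accepts_balanced : accepts M w -> selection_exists.
Proof.
move=> [cs [pcs halt acc]].
have [Ts [ts [Ts0 ts0 runs halts near]]] := run_sequence initial_trepresents pcs halt acc.
have J0 : 0 < J by [].
(* A transition carries a position only because all experts do; a fixed one is given to all. *)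
pose j0 := Ordinal J0.
pose selected (s j : 'I_J) (k : kind) := match k with
  | inl (inl t) => (j == j0) && (t == ts s)
  | inl (inr (h, a, x)) => (a == (Ts s h).1 j%:Z%R) && (x == head_action (Ts s) (ts s) h j)
  | _ => false end.
pose R : {set site} := [set x | selected x.1.1 x.1.2 x.2].
have le_cs : size cs <= margin d w by apply: leq_trans (runs_bound pcs) le_bound.
have rangeT s : in_range (Ts s).
  by apply: in_range_near le_cs => h; apply: near.
have fol (s : 'I_J) : follows R s (Ts s) (ts s).
  by split; [exists j0 => j t'; rewrite inE|move=> j h a x; rewrite inE].
have runs1 s := let: And4 r _ _ _ := runs s in r.
have runs2 s := let: And4 _ r _ _ := runs s in r.
have runs3 s := let: And4 _ _ r _ := runs s in r.
have runs4 s := let: And4 _ _ _ r := runs s in r.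
exists R => -[[s j] r] /=.
case: (boolP (is_token r)) => [tr|ntr].
  rewrite (follows_cons _ (fol s) tr).
  case sE : (nat_of_ord s) => [|n].
    rewrite [X in X + _](_ : _ = 0); last first.
      by apply: eq_card0 => x; rewrite !inE produces_at_start ?andbF.
    rewrite Ts0 ts0.
    case: r tr => [//|[[[[q|//]|[h a]]|h]|//]] _; rewrite /supplied_at /= cell_first sE eqxx /=.
    - by rewrite eq_sym.
    - by rewrite eq_sym.
    - by rewrite cell_origin eqz_nat.
  have lt : n < J by rewrite ltnW // -sE.
  have fol_n : follows R (Ordinal lt) (Ts n) (ts n) := fol (Ordinal lt).
  rewrite (follows_prod _ (rangeT n) _ fol_n tr) //.
  rewrite -runs1 runs2 (_ : supplied_at _ = false) ?addn0 //.
  by case: r tr => [//|[[[[q1|//]|[h a]]|h]|//]] _; rewrite /supplied_at /= cell_first sE.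
case: r ntr => [e|[[[[//|[[h a] b]]|[//]]|//]|[]]] _.
- rewrite !eq_card0 // => -[[s1 j1] [[t1|[[h1 a1] x1]]|r1]]; rewrite !inE ?andbF //=.
  by apply/andP => -[/andP[_ /eqP->]]; rewrite /consumes_at /=; case: e => [e|e]; rewrite runs3.
- by rewrite addn0 (follows_action _ _ _ (rangeT s) (fol s)).
rewrite [X in X + _](_ : _ = 0); last first.
  by apply: eq_card0 => -[[s1 j1] [[t1|[[h1 a1] x1]]|r1]]; rewrite !inE andbF.
(* The time of halting must be on the line for the halting transition to be among the experts. *)
have ltL : size cs < J.
  by rewrite lengthE; lia.
rewrite (@card_le1_mem _ _ (Ordinal ltL, j0, inl (inl (ts (size cs))))).
  by rewrite !inE /= !eqxx /consumes_at /= halts eqxx.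
move=> [[s1 j1] [[t1|[[h1 a1] x1]]|r1]]; rewrite !inE /consumes_at ?andbF //=.
case/andP => /andP[/eqP-> /eqP->]; rewrite halts => /eqP s1E.
by congr (_, _, _); [apply: val_inj|rewrite s1E].
Qed.

End Tokens.

(** * The team selection instance of a computation *)

Lemma map_enum_nth (T U : Type) (x0 : T) (s : seq T) (F : T -> U) :
  [seq F (nth x0 s i) | i : 'I_(size s) <- enum 'I_(size s)] = map F s.
Proof.
rewrite -[in RHS](mkseq_nth x0 s) /mkseq -map_comp -val_enum_ord -map_comp.
exact: eq_map.
Qed.

Lemma ohead_nth (s : seq bool) n : size s = n -> 0 < n -> ohead s = Some (nth false s 0).
Proof. by case: s => //= <-. Qed.

Section Grid.

Variables (T U : Type) (x0 : T) (y0 : U) (s : seq T) (t : seq U) (F : T -> U -> int).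
Hypothesis bounds : 0 < size t <= size s.

Definition grid_instance : instance := @Instance (size s) (size t) (size t)
  (\matrix_(i < size s, j < size t) ((F (nth x0 s i) (nth y0 t j))%:~R)%R)
  (0 : 'rV[rat]_(size t))%R (proj1 (andP bounds)) bounds.

Lemma code_grid_instance : code_instance grid_instance =
  code_nat (size s) ++ code_nat (size t) ++ code_nat (size t) ++
  flatten [seq code_int (F x y) | x <- s, y <- t] ++ flatten [seq code_int 0 | y <- t].
Proof.
rewrite /code_instance; congr (_ ++ (_ ++ (_ ++ (flatten _ ++ flatten _)))).
  rewrite -(map_enum_nth x0 s (fun x => [seq code_int (F x y) | y <- t])).
  congr flatten; apply: eq_map => i.
  rewrite -(map_enum_nth y0 t (fun y => code_int (F (nth x0 s i) y))).
  by apply: eq_map => j; rewrite mxE.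
rewrite -(map_enum_nth y0 t (fun _ => code_int 0)).
by apply: eq_map => j; rewrite mxE.
Qed.

End Grid.

Section Instance.

Variables (M : machine) (d : nat) (w : word).

Notation J := (size (line d w)).
Notation kind := (kind M).
Notation site := (site M d w).
Notation coef := (@coef kind d (@token_unit_weight M) (@token_weight M) w).
Notation irows := (rows kind J).
Notation iitems := (items kind J).

Let x0 : bool * option (nat * nat * kind) := (false, None).
Let y0 : option (nat * nat * kind) := None.

Lemma team_instance_bounds : 0 < size irows <= size iitems.
Proof. by rewrite size_items size_rows; lia. Qed.

Definition team_instance : instance := grid_instance x0 y0 coef team_instance_bounds.

Lemma code_team_instance : code_instance team_instance =
  instance_word d (@token_unit_weight M) (@token_weight M) w.
Proof. by rewrite code_grid_instance size_items. Qed.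

Definition position (x : site) : nat * nat * kind := (x.1.1 : nat, x.1.2 : nat, x.2).
Definition position_row (y : option site) := omap position y.
Definition position_item (x : bool * option site) := (x.1, position_row x.2).

(** The order is that of [coords], with bounded numbers: this puts the numbered experts and rounds
    of the instance in bijection with the finite types for which costs are defined. *)
Definition sites : seq site :=
  [seq (sj, k) | sj <- [seq (s, j) | s <- enum 'I_J, j <- enum 'I_J], k <- enum kind].
Definition site_rows : seq (option site) := None :: map Some sites.
Definition site_items : seq (bool * option site) :=
  [seq (b, y) | b <- [:: false; true], y <- site_rows].

Lemma position_sites : map position sites = coords kind J.
Proof.
rewrite /sites /coords.
have -> : [seq (s, j) | s <- iota 0 J, j <- iota 0 J] =
    map (fun sj : 'I_J * 'I_J => (sj.1 : nat, sj.2 : nat))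
        [seq (s, j) | s <- enum 'I_J, j <- enum 'I_J].
  by rewrite map_allpairs -val_enum_ord allpairs_mapl allpairs_mapr.
by rewrite [in RHS]allpairs_mapl [LHS](map_allpairs position (fun sj k => (sj, k))).

Qed.

Lemma position_rows : map position_row site_rows = irows.
Proof. by rewrite /site_rows /rows map_cons -position_sites -!map_comp. Qed.

Lemma position_items : map position_item site_items = iitems.
Proof. by rewrite /items -position_rows map_allpairs allpairs_mapr. Qed.

Lemma mem_sites x : x \in sites.
Proof.
case: x => [[s j] k]; apply/allpairsP; exists ((s, j), k); rewrite mem_enum; split=> //.
by apply/allpairsP; exists (s, j); rewrite !mem_enum.
Qed.

Lemma uniq_sites : uniq sites.
Proof.
apply: allpairs_uniq; rewrite ?enum_uniq //; last by move=> [x y] [x' y'] _ _ /= [-> ->].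
by apply: allpairs_uniq; rewrite ?enum_uniq //; move=> [x y] [x' y'] _ _ /= [-> ->].
Qed.

Lemma mem_site_rows y : y \in site_rows.
Proof. by case: y => [x|]; rewrite inE //= mem_map ?mem_sites // => ? ? []. Qed.

Lemma uniq_site_rows : uniq site_rows.
Proof.
rewrite /= map_inj_uniq ?uniq_sites ?andbT; last by move=> ? ? [].
by apply/mapP => -[].
Qed.

Lemma mem_site_items x : x \in site_items.
Proof.
case: x => b y; apply/allpairsP; exists (b, y); rewrite mem_site_rows; split=> //.
by case: b.
Qed.

Lemma uniq_site_items : uniq site_items.
Proof.
by apply: allpairs_uniq; rewrite ?uniq_site_rows //; move=> [x y] [x' y'] _ _ /= [-> ->].
Qed.

Lemma size_site_items : size site_items = size iitems.
Proof. by rewrite -position_items size_map. Qed.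

Lemma size_site_rows : size site_rows = size irows.
Proof. by rewrite -position_rows size_map. Qed.

Lemma card_site : #|site|.+1 = size irows.
Proof.
rewrite -size_site_rows /= size_map cardT; congr _.+1.
apply: perm_size; apply: uniq_perm; rewrite ?enum_uniq ?uniq_sites //.
by move=> x; rewrite mem_enum mem_sites.
Qed.

Definition site_item (i : 'I_(experts team_instance)) : bool * option site :=
  nth (false, None) site_items i.

Definition site_row (t : 'I_(rounds team_instance)) : option site := nth None site_rows t.

Lemma item_bij : bijective site_item.
Proof.
have lt x : index x site_items < experts team_instance.
  by rewrite -[experts _]/(size iitems) -size_site_items index_mem mem_site_items.
exists (fun x => Ordinal (lt x)) => [i|x].
  by apply: val_inj; rewrite [LHS]index_uniq ?uniq_site_items // size_site_items.
by rewrite [LHS]nth_index ?mem_site_items.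
Qed.

Lemma row_bij : bijective site_row.
Proof.
have lt x : index x site_rows < rounds team_instance.
  by rewrite -[rounds _]/(size irows) -size_site_rows index_mem mem_site_rows.
exists (fun x => Ordinal (lt x)) => [i|x].
  by apply: val_inj; rewrite [LHS]index_uniq ?uniq_site_rows // size_site_rows.
by rewrite [LHS]nth_index ?mem_site_rows.
Qed.

Notation entry := (@entry site (@consumes_at M d w) (@produces_at M d w) (@supplied_at M d w)).
Notation cost := (@cost site (@consumes_at M d w) (@produces_at M d w) (@supplied_at M d w)).

Lemma coef_entry (x : bool * option site) y :
  coef (position_item x) (position_row y) = entry x y.
Proof. by case: x y => [[] [[[s j] k]|]] [[[s' j'] r]|]. Qed.

Lemma predictionE i t : prediction team_instance i t = ((entry (site_item i) (site_row t))%:~R)%R.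
Proof.
rewrite mxE -coef_entry /site_item /site_row.
rewrite -(nth_map _ x0 position_item) ?position_items; last by rewrite size_site_items.
by rewrite -(nth_map _ y0 position_row) ?position_rows // size_site_rows.
Qed.

Lemma squared_errorE (S : {set 'I_(experts team_instance)}) :
  squared_error S = ((#|S|%:R^-1) ^+ 2 * (cost (site_item @: S))%:~R :> rat)%R.
Proof.
rewrite intr_cost (reindex site_row); last exact: onW_bij row_bij.
rewrite /squared_error mulr_sumr; apply: eq_bigr => t _.
rewrite mxE subr0 exprMn; congr (_ * _ ^+ 2)%R.
rewrite big_imset; last by move=> i i' _ _; apply: (bij_inj item_bij).
by apply: eq_bigr => i _; rewrite predictionE.
Qed.

Lemma card_item_set (S : {set 'I_(experts team_instance)}) : #|site_item @: S| = #|S|.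
Proof. exact: card_imset (bij_inj item_bij). Qed.

Lemma item_set_onto (S' : {set bool * option site}) :
  exists S : {set 'I_(experts team_instance)}, site_item @: S = S'.
Proof.
case: item_bij => g itemK gK; exists (g @: S'); rewrite -imset_comp.
by apply/setP => x; apply/imsetP/idP => [[y yS -> /=]|xS]; [rewrite gK|exists x; rewrite /= ?gK].
Qed.

Lemma team_size_card : team_size team_instance = #|site|.+1.
Proof. by rewrite card_site. Qed.

Lemma zero_error_balanced : (exists2 S : {set 'I_(experts team_instance)},
    #|S| = team_size team_instance & (squared_error S <= 0)%R) <->
  selection_exists M d w.
Proof.
split=> [[S cardS]|[R /balances_cost0[S' cardS' cost0]]]; last first.
  have [S SE] := item_set_onto S'; exists S; last first.
    by rewrite squared_errorE SE cost0 mulr0.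
  by rewrite team_size_card -card_item_set SE.
have m0 : (0 < (#|S|%:R^-1) ^+ 2 :> rat)%R.
  by rewrite exprn_gt0 // invr_gt0 ltr0n cardS team_size_card.
rewrite squared_errorE pmulr_rle0 // (lerz0 _ (cost _)) => cost_le0.
apply: (@cost0_balances _ _ _ _ (@balanced0 M d w) (site_item @: S)).
  by rewrite card_item_set cardS team_size_card.
apply/eqP; rewrite eq_le cost_le0 sumr_ge0 // => y _; exact: sqr_ge0.
Qed.

(** The signal expert is the first of [items], so its membership is the first bit of the code of the
    team. *)
Lemma optimal_team_signal (S : {set 'I_(experts team_instance)}) : optimal_team S ->
  ohead (code_team S) = Some false <-> selection_exists M d w.
Proof.
move=> [cardS opt].
have m0 : (0 < (#|S|%:R^-1) ^+ 2 :> rat)%R.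
  by rewrite exprn_gt0 // invr_gt0 ltr0n cardS team_size_card.
have cardS' : #|site_item @: S| = #|site|.+1 by rewrite card_item_set cardS team_size_card.
have := @optimal_signal _ _ _ _ (@balanced0 M d w) _ cardS'.
case=> [S'|bal1 bal2].
  have [S1 <-] := item_set_onto S'; rewrite card_item_set -team_size_card => cardS1.
  have := opt _ cardS1; rewrite !squared_errorE cardS1 -cardS ler_pM2l //.
  by rewrite ler_int.
have n0 : 0 < experts team_instance by rewrite -[experts _]/(size iitems) size_items size_rows.
pose i0 := Ordinal n0.
have sizeS : size (code_team S) = experts team_instance by rewrite size_map size_enum_ord.
rewrite (ohead_nth sizeS n0).
have -> : nth false (code_team S) 0 = (i0 \in S).
  rewrite (nth_map i0) ?size_enum_ord //; congr (_ \in S).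
  by apply: val_inj; apply: nth_enum_ord.
have item0 : site_item i0 = (false, None) by [].
have <- : ((false, None) \in site_item @: S) = (i0 \in S).
  by rewrite -item0 (mem_imset _ _ (bij_inj item_bij)).
move: bal1 bal2; case: (_ \in _) => bal1 bal2; split=> // h; last exact: bal2.
by have := bal1 h.
Qed.

End Instance.

Lemma poly_bounded_horner (p : {poly nat}) : poly_bounded (fun n => p.[n]%R).
Proof.
elim/poly_ind: p => [|p c IH].
  by apply: poly_bounded_le (poly_bounded_const 0) => n; rewrite horner0.
apply: (@poly_bounded_le _ (fun n => p.[n]%R * n + c)).
  by move=> n; rewrite hornerMXaddC.
exact: poly_bounded_add (poly_bounded_mul IH poly_bounded_id) (poly_bounded_const c).
Qed.

Lemma poly_bounded_poly f : poly_bounded f -> exists p : {poly nat}, forall n, f n <= p.[n]%R.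
Proof.
move=> [e le_f]; exists (('X + 2%:P) ^+ e)%R => n.
by rewrite horner_exp hornerD hornerX hornerC natrXE.
Qed.

Lemma poly_bounded_comp (p : {poly nat}) f : poly_bounded f -> poly_bounded (fun n => p.[f n]%R).
Proof.
move=> [b le_f]; have [a le_p] := poly_bounded_horner p.
have [c le_c] : poly_bounded (fun n => ((n + 2) ^ b + 2) ^ a).
  apply: poly_bounded_exp; apply: poly_bounded_add (poly_bounded_const 2).
  apply: poly_bounded_exp; exact: poly_bounded_add poly_bounded_id (poly_bounded_const 2).
exists c => n; apply: leq_trans (le_p _) (leq_trans _ (le_c n)).
by case: a {le_p le_c} => // a; rewrite leq_exp2r // leq_add2r.
Qed.

(** The exponent of a bound [(n + 2) ^ d] on [p] serves as [d], since the padded input has length at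
    least [n + 2]. *)
Lemma margin_bound (p : {poly nat}) : exists d, forall w, p.[size w]%R <= margin d w.
Proof.
have [d le_p] := poly_bounded_horner p; exists d => w.
apply: leq_trans (le_p _) _; rewrite /margin size_input_cells.
apply: (@leq_trans (input_length (size w) ^ d)).
  by case: d {le_p} => // d; rewrite leq_exp2r // /input_length; lia.
by rewrite leq_exp2l // /input_length.
Qed.

Section Decider.

Variables (M : machine) (p : {poly nat}).
Hypothesis M_time : forall w, runs_within M w p.[size w]%R.
Variable d : nat.
Hypothesis p_margin : forall w, p.[size w]%R <= margin d w.

Lemma accepts_iff_balanced w : accepts M w <-> selection_exists M d w.
Proof.
split; first exact: accepts_balanced (@M_time w) (p_margin w).
by move=> [R]; apply: balanced_accepts (@M_time w) (p_margin w) _.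
Qed.

Notation kind := (kind M).
Notation uw := (@token_unit_weight M).
Notation rw := (@token_weight M).

Definition decision_word (w : word) : word := instance_word d uw rw w ++ code_rat 0.

Lemma decision_word_correct w : accepts M w <-> team_selection_decision (decision_word w).
Proof.
rewrite accepts_iff_balanced -zero_error_balanced /decision_word -code_team_instance.
split=> [ex|[I [b [/code_instance_inj[IE]]]]].
  by exists (team_instance M d w), 0%R.
rewrite -[code_rat 0]cats0 -[code_rat b]cats0 => /code_rat_inj[<- _].
by rewrite -IE.
Qed.

Lemma decision_word_polytime : polytime_computable decision_word.
Proof.
have [f bf runf] := reduction_runs d void void (code_rat 0) (@token_unit_weight_in M)
  (@token_weight_in M).
have [q le_q] := poly_bounded_poly bf.
pose P := reduction d uw rw void void (code_rat 0).
(* The continuation has no transition: the machine halts as soon as the word is written and its head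
   is on the first bit. *)
pose delta := @then_delta _ _ P unit tt (fun _ _ => None).
pose N := named_machine delta (inl (pstart P)) set0.
exists N, q; split; first exact: named_deterministic.
move=> w _; have [_ [T [k exk lek] [TE _]]] := runf w.
have run := exec_nsteps tt (fun _ _ => None) exk.
have [within [c [rep [cs [pcs hc lc]] _]]] := named_machine_run set0 run (erefl _).
split.
  move=> cs' pcs'; apply: leq_trans (within _ pcs') (leq_trans lek (le_q _)).
exists (decision_word w) => //; exists cs; rewrite lc; split=> //.
have rep0 : represents (c.2 ord0) (T None).
  by have := rep.2 (tape_index None); rewrite tape_indexK.
by move: rep0; rewrite TE; apply: read_bits_segment.
Qed.

End Decider.

(** * From a solver to a decider *)

Section Composition.

Variables (d : nat) (N : machine).
Hypothesis N_det : deterministic N.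

Notation Y := 'I_(extra N).
Notation gsym := (gsym (aux N)).
Notation tname := (tname d Y).
Notation view := (view gsym tname).
Notation atapes := (atapes gsym tname).

Definition embed (s : symbol (aux N)) : symbol gsym :=
  match s with
  | Some (inl b) => Some (inl b)
  | Some (inr g) => Some (inr (inr g))
  | None => None
  end.

Definition unembed (s : symbol gsym) : symbol (aux N) :=
  match s with
  | Some (inl b) => Some (inl b)
  | Some (inr (inr g)) => Some (inr g)
  | _ => None
  end.

Lemma embedK : cancel embed unembed. Proof. by case=> [[]|]. Qed.

(* The input tape of [N] is that on which the instance has been written. *)
Definition solver_tape (i : 'I_(extra N).+1) : option tname :=
  omap inr (unlift ord0 i).

Definition solver_index (x : option tname) : option 'I_(extra N).+1 :=
  match x with
  | None => Some ord0
  | Some (inr j) => Some (lift ord0 j)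
  | _ => None
  end.

Lemma solver_tapeK i : solver_index (solver_tape i) = Some i.
Proof. by rewrite /solver_tape; case: unliftP => [j|] ->. Qed.

Definition solver_acts (am : {ffun 'I_(extra N).+1 -> symbol (aux N) * move})
    (v : view) : actions gsym tname := fun x =>
  if solver_index x is Some i then (embed (am i).1, (am i).2) else (v x, None).

(** The choice made by [pick] is the only possible one when [N] is deterministic. When [N] halts,
    one more step records in the state whether the first bit of its output is [false], and this
    state decides acceptance. *)
Definition solver_delta (s : state N + bool) (v : view) :
    option ((state N + bool) * actions gsym tname) :=
  match s with
  | inl q =>
      if [pick tr in trans q [ffun i => unembed (v (solver_tape i))]] is Some tr
      then Some (inl tr.1, solver_acts tr.2 v)
      else Some (inr (v None == Some (inl false)), keep v)
  | inr _ => None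
  end.

Definition embed_tape (t : tape (aux N)) : tape gsym := (map embed t.1, map embed t.2).

Lemma embed_act am (t : tape (aux N)) :
  embed_tape (act am t) = act (embed am.1, am.2) (embed_tape t).
Proof.
by case: am t => s [[]|] [l r]; rewrite /embed_tape /act /=; case: l; case: r.
Qed.

Lemma embed_scan (t : tape (aux N)) : scan (embed_tape t) = embed (scan t).
Proof. by case: t => l [|x r]. Qed.

Definition srepresents (c : config N) (T : atapes) : Prop :=
  forall i, represents (embed_tape (c.2 i)) (T (solver_tape i)).

Lemma srepresents_scan c T i : srepresents c T ->
  see T (solver_tape i) = embed (scan (c.2 i)).
Proof. by move=> rep; rewrite -embed_scan; symmetry; apply: represents_scan. Qed.

Lemma solver_sees c T : srepresents c T ->
  [ffun i => unembed (see T (solver_tape i))] = [ffun i => scan (c.2 i)].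
Proof. by move=> rep; apply/ffunP => i; rewrite !ffunE (srepresents_scan i rep) embedK. Qed.

Variables (p : prog gsym tname).

Notation delta := (then_delta (p := p) (inl (start N)) solver_delta).

Lemma solver_steps c cs T : srepresents c T -> path (@step N) c cs -> exists2 T',
  nsteps delta (size cs) (inr (inl c.1), T) = Some (inr (inl (last c cs).1), T') &
  srepresents (last c cs) T'.
Proof.
elim: cs c T => [|c' cs IH] c T rep /=; first by exists T.
case/andP => /existsP[tr /andP[trc /eqP c'E]] pcs.
have rep' : srepresents c' (apply_acts (solver_acts tr.2 (see T)) T).
  move=> i; rewrite c'E ffunE embed_act /apply_acts /solver_acts solver_tapeK.
  exact: represents_act (rep i).
have [T' run rep_last] := IH _ _ rep' pcs; exists T' => //.
rewrite /nstep /= (solver_sees rep); case: pickP => [tr' trc'|none]; last first.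
  by have := none tr; rewrite /= trc.
have /card_le1_eqP uniq := N_det c.1 [ffun i => scan (c.2 i)].
have -> : tr' = tr by apply: uniq.
by rewrite /= -run c'E.
Qed.

Lemma solver_halts c T : srepresents c T -> halted c ->
  nstep delta (inr (inl c.1), T) = Some (inr (inr (scan (c.2 ord0) == Some (inl false))), T).
Proof.
move=> rep hc; rewrite /nstep /= (solver_sees rep); case: pickP => [tr trc|_].
  by move: hc; rewrite /halted /moves => /eqP E; rewrite E inE in trc.
rewrite /= apply_keep; congr (Some (inr (inr _), _)).
have -> : None = solver_tape ord0 by rewrite /solver_tape unlift_none.
by rewrite (srepresents_scan ord0 rep); case: (scan _) => [[b|]|].
Qed.

(** The instance starts at [b] and not at the origin, which the solver cannot notice because
    [represents] is relative to the head. *)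
Lemma srepresents_init b v T : T None = (segment b (bits (aux N) v), b) ->
  (forall y, T (Some (inr y)) = blank (aux N)) -> srepresents (init N v) T.
Proof.
move=> TE TY i; rewrite ffunE /solver_tape.
case: unliftP => [j|] -> /=; first by rewrite TY; apply: represents_segment.
rewrite TE /embed_tape /= -map_comp; exact: represents_segment.
Qed.

(* The first bit of the answer of [N] tells whether the team contains the expert
   that signals the absence of a solution. *)
Definition composite : machine :=
  named_machine delta (inl (pstart p)) [set inr (inr true)].

Lemma composite_run w k T v b cs : exec p (@ainit _ _ w) k T ->
  T None = (segment b (bits (aux N) v), b) -> (forall y, T (Some (inr y)) = blank (aux N)) ->
  path (@step N) (init N v) cs -> halted (last (init N v) cs) ->
  runs_within composite w (k + (size cs + 1)) /\
  (accepts composite w <-> scan ((last (init N v) cs).2 ord0) = Some (inl false)).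
Proof.
move=> exk TE TY pcs hcs.
have [T' run rep] := solver_steps (srepresents_init TE TY) pcs.
have halts := solver_halts rep hcs.
set bit := scan _ == _ in halts.
have total : nsteps delta (k + (size cs + 1)) (inl (pstart p), @ainit _ _ w) =
    Some (inr (inr bit), T').
  by rewrite nsteps_add (exec_nsteps _ _ exk) /= nsteps_add run /= halts.
have [within [c [rc [cs' [pcs' hc lc]] uniq]]] :=
  named_machine_run [set inr (inr true)] total (erefl _).
split=> //; split=> [[cs2 [pcs2 hcs2 acc]]|bitE].
  by move: acc; rewrite (uniq _ pcs2 hcs2) rc.1 inE => /eqP[/eqP].
by exists cs'; rewrite lc; split=> //; rewrite rc.1 inE /bit bitE.
Qed.

End Composition.

Lemma NP_sub_P (N : machine) (q : {poly nat}) : deterministic N ->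
  (forall w, (exists v, team_selection w v) ->
     runs_within N w q.[size w]%R /\ exists2 v, team_selection w v & computes N w v) ->
  forall L, NP L -> P L.
Proof.
move=> N_det solves L [M [[p M_time] LM]].
have [d p_margin] := margin_bound p.
have [f bf runf] := reduction_runs d 'I_(extra N) (aux N) [::] (@token_unit_weight_in M)
  (@token_weight_in M).
set prg := reduction _ _ _ _ _ _ in runf.
(* Time to write the instance, time of the solver on a word of length at most [f n], and one step to
   record its answer. *)
have [r le_r] : exists r : {poly nat}, forall n, f n + (q.[f n]%R + 1) <= r.[n]%R.
  apply: poly_bounded_poly; apply: (poly_bounded_add bf).
  exact: poly_bounded_add (poly_bounded_comp q bf) (poly_bounded_const 1).
(* The time of the solver is bounded through the length of the instance, itself only bounded by
   [f (size w)]; coefficients in [nat] make [q] monotone. *)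
have mono : {homo (fun n => q.[n]%R) : m n / m <= n}.
  move=> m n le; elim/poly_ind: (q) => [|q' c IH]; first by rewrite !horner0.
  by rewrite !hornerMXaddC leq_add2r leq_mul.
have main w : runs_within (composite prg) w r.[size w]%R /\
    (L w <-> accepts (composite prg) w).
  have [size_le [T [k exk lek] [TE TY]]] := runf w.
  rewrite cats0 in size_le TE.
  set x := instance_word _ _ _ w in size_le TE.
  have xE : x = code_instance (team_instance M d w) by rewrite code_team_instance.
  (* The solver is only reliable on inputs that have an answer, and every instance has an optimal
     team. *)
  have dom : exists v, team_selection x v.
    have [S optS] := optimal_team_exists (team_instance M d w).
    by exists (code_team S), (team_instance M d w), S.
  have [within [v [I [S [IE vE optS]]] [cs [pcs hcs outE]]]] := solves x dom.
  have [wi acc] := composite_run N_det exk TE TY pcs hcs.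
  split.
    move=> cs' /wi le; apply: leq_trans (le_r _); apply: leq_trans le _.
    rewrite leq_add // leq_add2r; apply: leq_trans (within _ pcs) _.
    exact: mono.
  rewrite LM acc (accepts_iff_balanced M_time p_margin).
  (* The answer refers to some instance with the same code; injectivity of the code makes it the
     intended one. *)
  have IE' : team_instance M d w = I.
    by have := IE; rewrite xE -[code_instance I]cats0 -[LHS]cats0 => /code_instance_inj[].
  subst I.
  rewrite -(optimal_team_signal optS) -vE -outE /output /scan.
  by case: ((last _ cs).2 ord0).2 => [|[[b|g]|] s] //=; split=> [[->]|[->]].
exists (composite prg); first exact: named_deterministic.
by split; [exists r => w; case: (main w)|move=> w; case: (main w)].
Qed.

Theorem theorem1 :
  NP_hard team_selection_decision /\
  (solvable_in_polytime team_selection ->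
   forall L : language, P L <-> NP L).
Proof.
split=> [L [M [[p M_time] LM]]|[N [q [N_det solves]]] L].
  have [d p_margin] := margin_bound p.
  exists (decision_word M d); first exact: decision_word_polytime.
  by move=> w; rewrite LM; exact: (decision_word_correct M_time p_margin w).
split=> [[M _ dM]|]; first by exists M.
exact: NP_sub_P N_det solves L.
Qed.
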